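(* Let $\varphi(s)=s+\sum_{k\ge1}c_kk^{-s}\in\mathcal G_{>0}$ be univalent (on $\mathbb C_0$) with $\mathrm{Re}(c_1)>0$. Assume that its K\''onigs map belongs to $\mathcal G_{>0}$ and that $C_\varphi$ has dense range in $\mathcal H^2$. Then $C_\varphi$ is cyclic on $\mathcal H^2$.
   Context: For $\theta\in\mathbb R$, $\mathbb C_\theta=\{s:\mathrm{Re}\,s>\theta\}$. $\mathcal G_{>0}$ is the set of maps $\varphi(s)=c_0s+\psi(s)$ where $c_0\ge1$ is an integer (the characteristic), $\psi$ is a Dirichlet series converging uniformly in $\mathbb C_\varepsilon$ for every $\varepsilon>0$, and either $\psi\equiv i\tau$ for some $\tau\in\mathbb R$ or $\psi(\mathbb C_0)\subset\mathbb C_0$; such $\varphi$ is a self-map of $\mathbb C_0$. $\mathcal{GH}_{>0}$ is the set of holomorphic $u:\mathbb C_0\to\mathbb C$ of the form $u(s)=d_0s+\theta(s)$ with $d_0$ a positive integer (the characteristic) and $\theta$ a Dirichlet series converging uniformly on each $\mathbb C_\varepsilon$, $\varepsilon>0$. For $\varphi$ with characteristic $1$ and $\mathrm{Re}(c_1)>0$, the K\''onigs map of $\varphi$ is the map $u\in\mathcal{GH}_{>0}$ with characteristic $1$, unique up to an additive constant, such that $u\circ\varphi=u+c_1$; saying that it belongs to $\mathcal G_{>0}$ means that this holds for a suitable choice of the additive constant. $\mathcal H^2$ is the Hilbert space of Dirichlet series $f(s)=\sum_{n\ge1}a_nn^{-s}$ with $\|f\|=(\sum|a_n|^2)^{1/2}<\infty$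 (analytic on $\mathbb C_{1/2}$), and $C_\varphi f=f\circ\varphi$ is bounded on $\mathcal H^2$. An operator $T$ on a Hilbert space $H$ is cyclic if there is $x\in H$ such that $\{P(T)x:P\in\mathbb C[X]\}$ is dense in $H$. *)

(* Defs.v *)
From HB Require Import structures.
From mathcomp Require Import all_boot all_order all_algebra.
From mathcomp Require Import all_classical all_reals all_analysis.
From mathcomp Require Import complex ring lra.

Set Implicit Arguments.
Unset Strict Implicit.
Unset Printing Implicit Defensive.
Import Order.TTheory GRing.Theory Num.Theory.
Import numFieldNormedType.Exports.
Local Open Scope classical_set_scope.
Local Open Scope ring_scope.

(* R[i] as a normed space over itself, with the topology given by the complex
   modulus (MathComp-Analysis provides it on R[i]^o only). *)
HB.instance Definition _ (R : rcfType) := NormedModule.copy R[i] R[i]^o.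

Section DirichletSeries.
Context {R : realType}.
Implicit Types (a c : nat -> R[i]) (s : R[i]) (phi psi u : R[i] -> R[i]).

Definition half_plane (theta : R) : set R[i] := [set s | theta < complex.Re s].

(* n^{-s} = exp(-s ln n), for n >= 1. *)
Definition npow_opp (n : nat) s : R[i] :=
  let x := complex.Re s * ln n%:R in
  let y := complex.Im s * ln n%:R in
  (expR (- x))%:C%C * (cos y -i* sin y)%C.

(* Coefficients are indexed from 1, as in the usual notation; a 0 is not
   used. *)
Definition dirichlet_partial a (N : nat) s : R[i] :=
  \sum_(1 <= n < N.+1) a n * npow_opp n s.

Definition dirichlet_sum a s : R[i] := limn (fun N => dirichlet_partial a N s).

Definition dirichlet_expansion a psi : Prop :=
  forall e : R, 0 < e ->
    {uniform half_plane e, dirichlet_partial a N @[N --> \oo] --> psi}.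

(* phi(s) = d s + sum_{n >= 1} c_n n^{-s} belongs to G_{>0}.  Functions on
   C_0 are total functions of which only the values on C_0 matter. *)
Definition Gpos_expansion (d : nat) c phi : Prop :=
  (0 < d)%N /\
  exists psi,
    [/\ forall s, half_plane 0 s -> phi s = d%:R * s + psi s,
        dirichlet_expansion c psi &
        (exists tau : R, forall s, half_plane 0 s -> psi s = (0 +i* tau)%C) \/
        (forall s, half_plane 0 s -> half_plane 0 (psi s))].

Definition Gpos phi : Prop := exists d c, Gpos_expansion d c phi.

Definition GHpos (d : nat) u : Prop :=
  [/\ (0 < d)%N,
      forall s, half_plane 0 s -> derivable u s 1 &
      exists a theta,
        (forall s, half_plane 0 s -> u s = d%:R * s + theta s) /\
        dirichlet_expansion a theta].

Definition univalent phi : Prop := set_inj (half_plane 0) phi.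

(* u is a Koenigs map of phi(s) = s + c1 + ..., determined up to an additive
   constant. *)
Definition koenigs_map phi (c1 : R[i]) u : Prop :=
  GHpos 1 u /\ forall s, half_plane 0 s -> u (phi s) = u s + c1.

Definition koenigs_map_in_Gpos phi (c1 : R[i]) : Prop :=
  exists u, koenigs_map phi c1 u /\ exists k : R[i], Gpos (fun s => u s + k).

End DirichletSeries.

Section HardySpace.
Context {R : realType}.
Local Notation normc := (@Normc.normc R).

(* The square-summable coefficient sequences (a_n)_{n >= 1}; the condition
   a 0 = 0 makes a function on nat out of a family indexed by n >= 1. *)
Definition H2_pred : {pred nat -> R[i]} :=
  fun a => `[< a 0%N = 0 /\ cvgn (series (fun n => normc (a n) ^+ 2)) >].

Record H2 := MkH2 { H2_coef :> nat -> R[i]; H2_coefP : H2_coef \in H2_pred }.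

HB.instance Definition _ := [isSub for H2_coef].
HB.instance Definition _ := [Choice of H2 by <:].

Lemma H2_predP (a : nat -> R[i]) :
  a \in H2_pred <->
  a 0%N = 0 /\ cvgn (series (fun n => normc (a n) ^+ 2)).
Proof. by split=> [/asboolP|] // h; exact/asboolP. Qed.

Lemma normc_ge0 (x : R[i]) : 0 <= normc x.
Proof. by case: x => x y; exact: sqrtr_ge0. Qed.

Lemma normcZD_le (l x y : R[i]) :
  normc (l * x + y) ^+ 2 <=
  (2 * normc l ^+ 2) * normc x ^+ 2 + 2 * normc y ^+ 2.
Proof.
have := @le_normcD R (l * x) y.
rewrite Normc.normcM.
have := normc_ge0 (l * x + y); have := normc_ge0 l.
have := normc_ge0 x; have := normc_ge0 y; move: (normc (_ + _)).
move=> t hy hx hl ht htl.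
apply: (@le_trans _ _ ((normc l * normc x + normc y) ^+ 2)).
  by rewrite lerXn2r// nnegrE// addr_ge0// mulr_ge0.
have := sqr_ge0 (normc l * normc x - normc y); nra.
Qed.

Lemma H2_submod_closed : submod_closed H2_pred.
Proof.
split.
  apply/H2_predP; split=> //.
  rewrite [X in series X](_ : _ = fun=> 0).
    apply/cvg_ex; exists 0; rewrite /series/=.
    by under eq_fun do rewrite big1//; exact: cvg_cst.
  by apply/funext => n; rewrite Normc.normc0 expr0n.
move=> l a b /H2_predP[a0 ca] /H2_predP[b0 cb]; apply/H2_predP; split.
  by rewrite -[LHS]/(l * a 0%N + b 0%N) a0 b0 mulr0 addr0.
have cv := is_cvg_seriesD (is_cvg_seriesZ (k := 2 * normc l ^+ 2) ca)
                         (is_cvg_seriesZ (k := 2) cb).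
apply: series_le_cvg cv => n; rewrite ?sqr_ge0//; last exact: normcZD_le.
by rewrite addr_ge0// mulr_ge0// ?sqr_ge0// mulr_ge0// sqr_ge0.
Qed.

HB.instance Definition _ :=
  GRing.isSubmodClosed.Build R[i] (nat -> R[i]) H2_pred H2_submod_closed.
HB.instance Definition _ := [SubChoice_isSubLmodule of H2 by <:].


Definition H2_sqnorm (f : H2) : R := limn (series (fun n => normc (f n) ^+ 2)).

Definition H2_norm (f : H2) : R[i] := (Num.sqrt (H2_sqnorm f))%:C%C.

Lemma H2_cvg (f : H2) : cvgn (series (fun n => normc (f n) ^+ 2)).
Proof. by have /H2_predP[] := H2_coefP f. Qed.

Lemma H2_sqnorm_term (f : H2) n : normc (f n) ^+ 2 <= H2_sqnorm f.
Proof.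
have nd : nondecreasing_seq (series (fun n => normc (f n) ^+ 2)).
  by apply: nondecreasing_series => k _ _; exact: sqr_ge0.
apply: le_trans (nondecreasing_cvgn_le nd (@H2_cvg f) n.+1).
rewrite /series/= big_nat_recr//= lerDr.
by apply: sumr_ge0 => k _; exact: sqr_ge0.
Qed.

Lemma H2_sqnorm_ge0 (f : H2) : 0 <= H2_sqnorm f.
Proof. by apply: le_trans (H2_sqnorm_term f 0%N); exact: sqr_ge0. Qed.

Lemma H2_sqnorm_eq0 (f : H2) : H2_sqnorm f = 0 -> f = 0.
Proof.
move=> f0; apply/val_inj/funext => n /=.
apply: Normc.eq0_normc; apply/eqP; rewrite -sqrf_eq0 eq_le sqr_ge0 andbT -f0.
exact: H2_sqnorm_term.
Qed.

Lemma H2_norm_eq0 (f : H2) : H2_norm f = 0 -> f = 0.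
Proof.
move=> [/eqP]; rewrite sqrtr_eq0 => f0; apply: H2_sqnorm_eq0; apply/eqP.
by rewrite eq_le f0 H2_sqnorm_ge0.
Qed.

Lemma H2_normZ (l : R[i]) (f : H2) : H2_norm (l *: f) = `|l| * H2_norm f.
Proof.
rewrite /H2_norm.
have -> : H2_sqnorm (l *: f) = normc l ^+ 2 * H2_sqnorm f.
  rewrite -[RHS](lim_seriesZ _ (@H2_cvg f)); congr (limn (series _)).
  by apply/funext => n /=; rewrite Normc.normcM exprMn.
rewrite sqrtrM ?sqr_ge0// sqrtr_sqr ger0_norm ?normc_ge0//.
by rewrite rmorphM.
Qed.

(* (x + y)^2 <= (A + B) (x^2 / A + y^2 / B), summed over the coefficients with
   A and B the norms of f and g. *)
Lemma H2_normD (f g : H2) : H2_norm (f + g) <= H2_norm f + H2_norm g.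
Proof.
have [f0|fN0] := eqVneq (H2_sqnorm f) 0.
  rewrite (H2_sqnorm_eq0 f0) add0r lerDr lecR; exact: sqrtr_ge0.
have [g0|gN0] := eqVneq (H2_sqnorm g) 0.
  rewrite (H2_sqnorm_eq0 g0) addr0 lerDl lecR; exact: sqrtr_ge0.
rewrite /H2_norm -rmorphD lecR.
set A := Num.sqrt (H2_sqnorm f); set B := Num.sqrt (H2_sqnorm g).
have A0 : 0 < A by rewrite sqrtr_gt0 lt0r fN0 H2_sqnorm_ge0.
have B0 : 0 < B by rewrite sqrtr_gt0 lt0r gN0 H2_sqnorm_ge0.
rewrite -[leRHS]ger0_norm; last by rewrite addr_ge0// ltW.
rewrite -sqrtr_sqr ler_sqrt ?sqr_ge0//.
have fA : H2_sqnorm f = A ^+ 2 by rewrite sqr_sqrtr ?H2_sqnorm_ge0.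
have gB : H2_sqnorm g = B ^+ 2 by rewrite sqr_sqrtr ?H2_sqnorm_ge0.
have cf := is_cvg_seriesZ (k := (A + B) / A) (@H2_cvg f).
have cg := is_cvg_seriesZ (k := (A + B) / B) (@H2_cvg g).
have -> : (A + B) ^+ 2 =
    limn (series ((A + B) / A *: (fun n => normc (f n) ^+ 2) +
                  (A + B) / B *: (fun n => normc (g n) ^+ 2))).
  rewrite lim_seriesD// lim_seriesZ; last exact: H2_cvg.
  rewrite lim_seriesZ; last exact: H2_cvg.
  rewrite -/(H2_sqnorm f) -/(H2_sqnorm g) fA gB /GRing.scale/=.
  by field; rewrite !gt_eqF.
apply: lim_series_le; [exact: H2_cvg|exact: is_cvg_seriesD|move=> n].
rewrite -[leLHS]/(normc (f n + g n) ^+ 2).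
rewrite -[leRHS]/((A + B) / A * normc (f n) ^+ 2 +
                  (A + B) / B * normc (g n) ^+ 2).
have := @le_normcD R (f n) (g n).
have := normc_ge0 (f n + g n); have := normc_ge0 (f n); have := normc_ge0 (g n).
move: (normc (f n)) (normc (g n)) (normc (_ + _)) => x y t y0 x0 t0 txy.
apply: (@le_trans _ _ ((x + y) ^+ 2)).
  by rewrite lerXn2r// nnegrE addr_ge0.
rewrite -subr_ge0 (_ : _ - _ = (B * x - A * y) ^+ 2 / (A * B)).
  by rewrite divr_ge0 ?sqr_ge0// mulr_ge0// ltW.
by field; rewrite !gt_eqF.
Qed.

HB.instance Definition _ :=
  Lmodule_isNormed.Build R[i] H2 H2_normD H2_normZ H2_norm_eq0.

(* The series converges on C_{1/2}; limn is a junk value elsewhere. *)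
Definition H2_eval (f : H2) : R[i] -> R[i] := dirichlet_sum f.

(* C_phi f is the element of H^2 that coincides with f \o phi on C_{1/2}.
   For phi in G_{>0} it exists for every f (Gordon-Hedenmalm) and it is unique;
   the default value 0 of xget is then never used. *)
Definition comp_op (phi : R[i] -> R[i]) (f : H2) : H2 :=
  xget 0 [set g : H2 | forall s, half_plane 2^-1 s ->
                         H2_eval g s = H2_eval f (phi s)].

End HardySpace.
Arguments H2 R : clear implicits.

Definition poly_op (K : numFieldType) (V : normedModType K) (T : V -> V)
    (P : {poly K}) (x : V) : V :=
  \sum_(i < size P) P`_i *: iter i T x.

Definition cyclic_op (K : numFieldType) (V : normedModType K) (T : V -> V) :
    Prop :=
  exists x : V, dense [set poly_op T P x | P in [set: {poly K}]].

(* Main.v *)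
From HB Require Import structures.
Require Import Defs.
From mathcomp Require Import all_boot all_order all_algebra.
From mathcomp Require Import all_classical all_reals all_analysis.
From mathcomp Require Import complex ring lra.
Import Order.TTheory GRing.Theory Num.Theory.
Import numFieldNormedType.Exports.
Local Open Scope classical_set_scope.
Local Open Scope ring_scope.
Set Implicit Arguments.
Unset Strict Implicit.
Unset Printing Implicit Defensive.

(** Let v be the Koenigs map, normalized so that v(s) = s + psi(s) with
Re psi >= 0; then v o phi = v + c_1.  Composing with v turns phi into the
translation tau(s) = s + c_1: C_phi C_v = C_v C_tau.  The operator C_tau is
diagonal in the basis (n^{-s}) with eigenvalues n^{-c_1}, whose moduli decrease
strictly because Re c_1 > 0; a vector f without zero coefficient is therefore
cyclic for it, as the rescaled orbit isolates the basis vectors one after the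
other (diagonal_cyclic, shift_cyclic).  If C_v is bounded with dense range, then
C_v f is cyclic for C_phi (cyclic_op_transfer).

Density of the range of C_v (dense_range_koenigs).  Far to the right v is a
small perturbation of a translation, hence has an inverse h there, again the
identity plus a uniform limit of Dirichlet polynomials (inverse_near_infinity).
For n large, h_n(w) = h(w + n c_1) is defined on all of C_0 and
phi^n = h_n o v.  So C_phi^n = C_v C_{h_n}, and the range of C_v contains the
range of C_phi^n, which is dense since C_phi is continuous with dense range.

Boundedness.  All the operators above are C_chi with chi(s) = s + psi(s), where
Re psi >= 0 on C_0 and psi is on each C_e, e > 0, a uniform limit of Dirichlet
polynomials; these form the class called symbol.  The contractivity of C_chi
(comp_exists, the case of characteristic 1 of the Gordon-Hedenmalm theorem) is
obtained without integration.  For a Dirichlet polynomial f = sum a_n n^{-s} and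
Re w >= 0, a summation by parts gives
  |f(w)|^2 <= sum |a_n|^2 + 2 Re sum_{n < m} a_m conj(a_n) (m/n)^{-w}
(sqnorm_dirichlet_partial_le).  Put w = chi(s) and take the mean over a vertical
line: (m/n)^{-chi} = (m/n)^{-s} (m/n)^{-psi} only contains the frequencies
ln(m/n) + ln k > 0, so its mean vanishes, and the mean of |f o chi|^2 is at most
sum |a_n|^2 (wsqnorm_comp_le).  The only fact on means that is needed is that a
nonnegative trigonometric polynomial has a nonnegative constant term, and
averaging F(t) and F(t + pi / lam) removes the frequency lam exactly
(osc_mean). *)

(** * Modulus and convergence of complex numbers *)

Section ComplexNorm.
Context {R : realType}.
Implicit Types (x y z : R[i]).
Local Notation cnorm := (@Normc.normc R).
Local Notation Re := (@complex.Re R).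
Local Notation Im := (@complex.Im R).

Lemma cReD x y : Re (x + y) = Re x + Re y. Proof. by case: x; case: y. Qed.
Lemma cImD x y : Im (x + y) = Im x + Im y. Proof. by case: x; case: y. Qed.
Lemma cReN x : Re (- x) = - Re x. Proof. by case: x. Qed.
Lemma cImN x : Im (- x) = - Im x. Proof. by case: x. Qed.
Lemma cReB x y : Re (x - y) = Re x - Re y. Proof. by rewrite cReD cReN. Qed.
Lemma cImB x y : Im (x - y) = Im x - Im y. Proof. by rewrite cImD cImN. Qed.
Lemma cReM x y : Re (x * y) = Re x * Re y - Im x * Im y.
Proof. by case: x; case: y. Qed.
Lemma cImM x y : Im (x * y) = Re x * Im y + Im x * Re y.
Proof. by case: x; case: y. Qed.
Lemma cReZ (r : R) x : Re (r%:C%C * x) = r * Re x.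
Proof. by rewrite cReM/= mul0r subr0. Qed.
Lemma cRe_sum (I : Type) (r : seq I) (P : pred I) (F : I -> R[i]) :
  Re (\sum_(i <- r | P i) F i) = \sum_(i <- r | P i) Re (F i).
Proof. by elim/big_rec2 : _ => //= i y1 y2 _ <-; rewrite cReD. Qed.

Lemma cnormE x : cnorm x = Num.sqrt (Re x ^+ 2 + Im x ^+ 2).
Proof. by case: x. Qed.

Lemma cnorm_sqr x : cnorm x ^+ 2 = Re x ^+ 2 + Im x ^+ 2.
Proof. by rewrite cnormE sqr_sqrtr// addr_ge0// sqr_ge0. Qed.

Lemma cRe_le_cnorm x : `|Re x| <= cnorm x.
Proof.
by rewrite cnormE -sqrtr_sqr ler_sqrt ?addr_ge0 ?sqr_ge0// lerDl sqr_ge0.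
Qed.

Lemma cIm_le_cnorm x : `|Im x| <= cnorm x.
Proof.
by rewrite cnormE -sqrtr_sqr ler_sqrt ?addr_ge0 ?sqr_ge0// lerDr sqr_ge0.
Qed.

Lemma cnorm_real (r : R) : cnorm r%:C%C = `|r|.
Proof. by rewrite /= expr0n/= addr0 sqrtr_sqr. Qed.

Lemma cnorm_nat n : cnorm n%:R = n%:R.
Proof. by rewrite -(rmorph_nat (real_complex R)) cnorm_real ger0_norm. Qed.

Lemma cnorm_le_ReIm x : cnorm x <= `|Re x| + `|Im x|.
Proof.
have h : 0 <= `|Re x| + `|Im x| by rewrite addr_ge0.
rewrite cnormE -[leRHS]ger0_norm// -sqrtr_sqr ler_sqrt ?sqr_ge0//.
rewrite sqrrD !real_normK ?num_real// lerD2r lerDl.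
by rewrite mulrn_wge0// mulr_ge0.
Qed.

Lemma cnormB x y : cnorm (x - y) <= cnorm x + cnorm y.
Proof. by rewrite -(normcN y); exact: le_normcD. Qed.

Lemma cdistC x y : cnorm (x - y) = cnorm (y - x).
Proof. by rewrite -normcN opprB. Qed.

Lemma cdistD y x z : cnorm (x - z) <= cnorm (x - y) + cnorm (y - z).
Proof. by have := le_normcD (x - y) (y - z); rewrite addrA subrK. Qed.

Lemma cnorm_ler_dist x y : cnorm x <= cnorm (x - y) + cnorm y.
Proof. by have := le_normcD (x - y) y; rewrite subrK. Qed.

Lemma cnorm_sum (I : Type) (r : seq I) (P : pred I) (F : I -> R[i]) :
  cnorm (\sum_(i <- r | P i) F i) <= \sum_(i <- r | P i) cnorm (F i).
Proof.
elim/big_rec2 : _ => [|i y1 y2 _ h]; first by rewrite Normc.normc0.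
by apply: le_trans (le_normcD _ _) _; rewrite lerD2l.
Qed.

Lemma cnormX x n : cnorm (x ^+ n) = cnorm x ^+ n.
Proof.
by elim: n => [|n IH]; rewrite ?expr0 ?Normc.normc1// !exprS Normc.normcM IH.
Qed.

Lemma cvg_cnormP (z : nat -> R[i]) l :
  (z n @[n --> \oo] --> l) <->
  (forall e : R, 0 < e -> \forall n \near \oo, cnorm (z n - l) <= e).
Proof.
split.
  move=> /cvgrPdist_le h e e0.
  have e0' : 0 < (e%:C)%C by rewrite ltcR.
  have := h _ e0'; apply: filterS => n.
  by rewrite cdistC -lecR.
move=> h; apply/cvgrPdist_le => -[e e'].
rewrite ltcE/= => /andP[/eqP -> e0].
have := h _ e0; apply: filterS => n hn.
by rewrite -[leLHS]/((cnorm (l - z n))%:C)%C lecR cdistC.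
Qed.

Lemma cvg_cnorm_le (z : nat -> R[i]) l (M : R) :
  z n @[n --> \oo] --> l -> (\forall n \near \oo, cnorm (z n) <= M) ->
  cnorm l <= M.
Proof.
move=> /cvg_cnormP zl zM; apply/ler_addgt0Pr => e e0.
near \oo => n.
have h1 : cnorm (z n - l) <= e by near: n; exact: zl.
have h2 : cnorm (z n) <= M by near: n.
by apply: le_trans (cnorm_ler_dist l (z n)) _; rewrite cdistC addrC lerD.
Unshelve. all: by end_near. Qed.

Lemma ccauchy_cvg (z : nat -> R[i]) :
  (forall e : R, 0 < e ->
     exists N, forall n m, (N <= n)%N -> (N <= m)%N -> cnorm (z n - z m) <= e) ->
  exists l : R[i], z n @[n --> \oo] --> l.
Proof.
move=> h.
have reS (f : R[i] -> R) : (forall x y, `|f x - f y| <= cnorm (x - y)) ->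
    exists a : R, f (z n) @[n --> \oo] --> a.
  move=> hf.
  suff /cvg_ex[a ha] : cvgn (f \o z) by exists a.
  apply/cauchy_cvgP/cauchy_ballP => e e0.
  have e20 : 0 < e / 2 by rewrite divr_gt0.
  have [N hN] := h _ e20.
  pose A := (f \o z) @` [set n | (N <= n)%N].
  exists (A, A); first by split; exists N => // n /= Nn; exists n.
  move=> [_ _] /= [[n Nn <-] [m Nm <-]]; rewrite /ball/=.
  apply: le_lt_trans (hf _ _) _; apply: le_lt_trans (hN _ _ Nn Nm) _.
  by rewrite ltr_pdivrMr// ltr_pMr// ltr1n.
have [a ha] := reS Re (fun x y => ltac:(rewrite -cReB; exact: cRe_le_cnorm)).
have [b hb] := reS Im (fun x y => ltac:(rewrite -cImB; exact: cIm_le_cnorm)).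
exists (a +i* b)%C; apply/cvg_cnormP => e e0.
have e20 : 0 < e / 2 by rewrite divr_gt0.
move/cvgrPdist_le: ha => /(_ _ e20) ha.
move/cvgrPdist_le: hb => /(_ _ e20) hb.
near=> n; apply: le_trans (cnorm_le_ReIm _) _.
rewrite cReB cImB/= (splitr e) lerD//; first by rewrite distrC; near: n.
by rewrite distrC; near: n.
Unshelve. all: by end_near. Qed.

End ComplexNorm.

(** * The complex exponential and the functions n^{-s} *)

Section ComplexExponential.
Context {R : realType}.
Implicit Types (x y z s : R[i]) (r : R).
Local Notation cnorm := (@Normc.normc R).
Local Notation Re := (@complex.Re R).
Local Notation Im := (@complex.Im R).

Lemma cos_half r : 1 - cos r = 2 * sin (r / 2) ^+ 2.
Proof.
have {1}-> : r = (r / 2) *+ 2 by rewrite -mulr_natr divfK.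
by rewrite cos_mulr2n cos2sin2 -mulr_natr; ring.
Qed.

Lemma ger0_sinBid r : 0 <= r -> `|sin r| <= r /\ `|sin r - r| <= r * (r ^+ 2 / 2).
Proof.
rewrite le_eqVlt => /predU1P[<-|r0].
  by rewrite sin0 subrr normr0 mul0r.
have ds (x : R) : x \in `]0, r[ -> is_derive x (1:R) sin (cos x).
  by move=> _; exact: is_derive_sin.
have cs : {within `[0, r], continuous (@sin R)}.
  by apply: continuous_subspaceT => ?; exact: continuous_sin.
have sinle (t : R) : 0 < t -> `|sin t| <= t.
  move=> t0.
  have ct : {within `[0, t], continuous (@sin R)}.
    by apply: continuous_subspaceT => ?; exact: continuous_sin.
  have [c _] := MVT t0 (fun (u : R) _ => is_derive_sin u) ct.
  rewrite sin0 !subr0 => ->; rewrite normrM (gtr0_norm t0) ler_piMl ?(ltW t0)//.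
  exact: cos_max.
have [c] := MVT r0 ds cs.
rewrite in_itv/= => /andP[c0 cr]; rewrite sin0 !subr0 => sr.
split; first exact: sinle.
rewrite sr -[X in _ - X]mul1r -mulrBl normrM (gtr0_norm r0) mulrC.
rewrite ler_wpM2l ?(ltW r0)//.
have -> : cos c - 1 = - (2 * sin (c / 2) ^+ 2).
  by rewrite -cos_half; ring.
rewrite normrN normrM normrX ger0_norm//.
have c20 : 0 < c / 2 by rewrite divr_gt0.
have := sinle _ c20; have := normr_ge0 (sin (c / 2)).
move: `|_| => t t0 tc; nra.
Qed.

Lemma sin_le_norm r : `|sin r| <= `|r|.
Proof.
have [r0|r0] := leP 0 r; first by rewrite (ger0_norm r0); case: (ger0_sinBid r0).
have nr0 : 0 <= - r by rewrite oppr_ge0 ltW.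
by rewrite (ltr0_norm r0) -normrN -sinN; case: (ger0_sinBid nr0).
Qed.

Lemma cos_ge r : 1 - cos r <= r ^+ 2 / 2.
Proof.
rewrite cos_half.
have := sin_le_norm (r / 2); rewrite -ler_sqr ?nnegrE// !real_normK ?num_real//.
by move=> h; nra.
Qed.

Lemma sinBid_le r : `|sin r - r| <= `|r| ^+ 3 / 2.
Proof.
have [r0|r0] := leP 0 r.
  have [_] := ger0_sinBid r0; rewrite (ger0_norm r0) => h.
  by apply: le_trans h _; rewrite [leRHS](_ : _ = r * (r ^+ 2 / 2))//; ring.
have nr0 : 0 <= - r by rewrite oppr_ge0 ltW.
have [_] := ger0_sinBid nr0; rewrite (ltr0_norm r0) sinN -opprD normrN => h.
by apply: le_trans h _; rewrite [leRHS](_ : _ = - r * ((- r) ^+ 2 / 2))//; ring.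
Qed.

Definition cexp z : R[i] := (expR (Re z))%:C%C * (cos (Im z) +i* sin (Im z))%C.

Lemma cexpD x y : cexp (x + y) = cexp x * cexp y.
Proof.
rewrite /cexp cReD cImD expRD cosD sinD; apply/eqP; rewrite eq_complex.
by rewrite !(cReM, cImM)/=; apply/andP; split; apply/eqP; ring.
Qed.

Lemma cexp0 : cexp 0 = 1.
Proof. by rewrite /cexp/= expR0 cos0 sin0 mul1r. Qed.

Lemma cnorm_cexp z : cnorm (cexp z) = expR (Re z).
Proof.
rewrite /cexp Normc.normcM cnorm_real/= cos2Dsin2 sqrtr1 mulr1.
by rewrite ger0_norm ?expR_ge0.
Qed.

Lemma cexpX z n : cexp z ^+ n = cexp (n%:R * z).
Proof.
elim: n => [|n IH]; first by rewrite mul0r cexp0.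
by rewrite exprS IH -cexpD -[in X in X + _](mul1r z) -mulrDl -natr1 addrC.
Qed.

(** This bound has no exponential factor, because Re z <= 0; it gives Lipschitz
estimates on half-planes, see cexp_dist_le. *)
Lemma cexpB1 z : Re z <= 0 -> cnorm (cexp z - 1) <= 2 * cnorm z.
Proof.
move=> z0.
have -> : cexp z - 1 = (expR (Re z))%:C%C * ((cos (Im z) +i* sin (Im z))%C - 1)
   + (expR (Re z) - 1)%:C%C.
  by rewrite /cexp rmorphB rmorph1; ring.
apply: le_trans (le_normcD _ _) _.
rewrite mulr_natl mulr2n lerD//; last first.
  rewrite cnorm_real ler0_norm ?subr_le0 ?expR_le1//.
  apply: le_trans (cRe_le_cnorm z); rewrite ler0_norm//.
  by have := expR_ge1Dx (Re z); lra.
rewrite Normc.normcM cnorm_real ger0_norm ?expR_ge0//.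
apply: (@le_trans _ _ (cnorm ((cos (Im z) +i* sin (Im z))%C - 1))).
  by rewrite ler_piMl ?normc_ge0// expR_le1.
apply: le_trans (cIm_le_cnorm z).
rewrite -ler_sqr ?nnegrE ?normc_ge0// real_normK ?num_real// cnorm_sqr.
rewrite cReB cImB/= subr0.
have := cos2Dsin2 (Im z); have := cos_ge (Im z).
move: (cos _) (sin _) => c d h1 h2; nra.
Qed.

Lemma cexp_dist_le x y r : Re x <= r -> Re y <= r ->
  cnorm (cexp x - cexp y) <= 2 * expR r * cnorm (x - y).
Proof.
wlog: x y / Re x <= Re y => [H xr yr|xy xr yr].
  have [h|/ltW h] := leP (Re x) (Re y); first exact: H.
  by rewrite cdistC (cdistC x); apply: H.
have -> : cexp x - cexp y = cexp y * (cexp (x - y) - 1).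
  by rewrite mulrBr -cexpD mulr1 (addrC y) subrK.
rewrite Normc.normcM cnorm_cexp -mulrA mulrCA.
apply: ler_pM; rewrite ?expR_ge0 ?normc_ge0 ?ler_expR//.
by apply: cexpB1; rewrite cReB subr_le0.
Qed.

Lemma cexp_taylor1 z : cnorm z <= 1 / 2 ->
  cnorm (cexp z - (1 + z)) <= 4 * cnorm z ^+ 2.
Proof.
move=> z2.
apply: le_trans (cnorm_le_ReIm _) _; rewrite cnorm_sqr cReB cImB cReD cImD.
rewrite /cexp cReM cImM/= !mul0r subr0 addr0 add0r.
have := le_trans (cRe_le_cnorm z) z2; have := le_trans (cIm_le_cnorm z) z2.
move: (Re z) (Im z) => x y; rewrite !ler_norml => /andP[y1 y2] /andP[x1 x2].
have e1 := expR_ge1Dx x.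
have e2 : expR x - 1 - x <= 2 * x ^+ 2.
  have := expR_ge1Dx (- x); rewrite expRN => h.
  have e0 := expR_gt0 x.
  have h' : (1 - x) * expR x <= 1 by rewrite -ler_pdivlMr// div1r.
  by nra.
have e0 := expR_gt0 x.
have e3 : expR x <= 2 by nra.
have c1 := cos_ge y; have c2 := cos_le1 y.
have s1 := sinBid_le y; have s2 := sin_le_norm y.
have hre : `|expR x * cos y - (1 + x)| <= 2 * x ^+ 2 + y ^+ 2.
  by rewrite ler_norml; apply/andP; split; nra.
have ex1 : `|expR x - 1| <= 2 * `|x|.
  have xn : x <= `|x| by exact: ler_norm.
  have xn' : - x <= `|x| by rewrite -normrN; exact: ler_norm.
  have xx : x ^+ 2 <= 1/2 * `|x|.
    rewrite -real_normK ?num_real//.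
    have : `|x| <= 1/2 by rewrite ler_norml; apply/andP; split; lra.
    by have := normr_ge0 x; nra.
  by rewrite ler_norml; apply/andP; split; nra.
have yy : `|y| <= 1 / 2 by rewrite ler_norml; apply/andP; split; lra.
have him : `|expR x * sin y - y| <= 2 * `|x| * `|y| + `|y| ^+ 3 / 2.
  have -> : expR x * sin y - y = (expR x - 1) * sin y + (sin y - y) by ring.
  apply: le_trans (ler_normD _ _) _; rewrite lerD// normrM.
  by apply: ler_pM.
have := real_normK (num_real x); have := real_normK (num_real y).
move: him hre yy ex1 => + + + _.
have := normr_ge0 x; have := normr_ge0 y.
move: `|x| `|y| `|_ * cos _ - _| `|_ * sin _ - _| => a b u v b0 a0 h1 h2 h3 h4 h5.
have : b ^+ 3 <= b ^+ 2 by nra.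
by have := sqr_ge0 (a - b); nra.
Qed.

Lemma subrX_cnorm_le x y (M : R) m : cnorm x <= M -> cnorm y <= M ->
  cnorm (x ^+ m.+1 - y ^+ m.+1) <= m.+1%:R * M ^+ m * cnorm (x - y).
Proof.
move=> xM yM; have M0 : 0 <= M by apply: le_trans xM; exact: normc_ge0.
elim: m => [|m IH]; first by rewrite !expr1 mul1r mul1r.
have -> : x ^+ m.+2 - y ^+ m.+2 =
  x * (x ^+ m.+1 - y ^+ m.+1) + (x - y) * y ^+ m.+1.
  by rewrite mulrBr mulrBl -!exprS addrA subrK.
apply: le_trans (le_normcD _ _) _; rewrite !Normc.normcM cnormX.
rewrite -(natr1 m.+1) 2!mulrDl mul1r lerD//; last first.
  by rewrite mulrC ler_wpM2r ?normc_ge0// lerXn2r// nnegrE normc_ge0.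
rewrite (exprS M) (mulrCA m.+1%:R M) -(mulrA M).
by apply: ler_pM; rewrite ?normc_ge0.
Qed.

(** The powers (1 + z/m)^m stand in for the exponential series: they suffice to see
that exp preserves uniform limits of Dirichlet polynomials.  The rate comes from
x^m - y^m with x = exp(z/m), y = 1 + z/m, both of modulus at most exp(|z|/m). *)
Lemma cexp_powers z m : cnorm z <= m.+1%:R / 2 ->
  cnorm (cexp z - (1 + z / m.+1%:R) ^+ m.+1) <=
  4 * cnorm z ^+ 2 * expR (cnorm z) / m.+1%:R.
Proof.
move=> zm; set w := z / m.+1%:R.
have n0 : 0 < m.+1%:R :> R by [].
have nw : cnorm w = cnorm z / m.+1%:R.
  by rewrite /w Normc.normcM Normc.normcV cnorm_nat.
have -> : cexp z = cexp w ^+ m.+1.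
  by rewrite cexpX /w mulrCA divff ?mulr1// pnatr_eq0.
have w2 : cnorm w <= 1/2 by rewrite nw ler_pdivrMr// mulrC mulrA mulr1.
have ew : cnorm (cexp w) <= expR (cnorm w).
  by rewrite cnorm_cexp ler_expR; apply: le_trans (cRe_le_cnorm w); exact: ler_norm.
have ew' : cnorm (1 + w) <= expR (cnorm w).
  by apply: le_trans (le_normcD _ _) _; rewrite Normc.normc1; exact: expR_ge1Dx.
apply: le_trans (subrX_cnorm_le _ ew ew') _.
have -> : cnorm z = cnorm w * m.+1%:R by rewrite nw divfK// gt_eqF.
apply: (@le_trans _ _
  (m.+1%:R * expR (cnorm w) ^+ m * (4 * cnorm w ^+ 2))).
  by rewrite ler_wpM2l ?cexp_taylor1// mulr_ge0// exprn_ge0// expR_ge0.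
rewrite (mulrC (cnorm w)) expRM_natl (exprS (expR _)).
have -> : 4 * (m.+1%:R * cnorm w) ^+ 2 * (expR (cnorm w) * expR (cnorm w) ^+ m) /
  m.+1%:R = m.+1%:R * expR (cnorm w) ^+ m * (4 * cnorm w ^+ 2) * expR (cnorm w).
  by field; rewrite addrC natr1 gt_eqF.
rewrite ler_peMr//; last by rewrite -expR0 ler_expR normc_ge0.
by rewrite !mulr_ge0// ?exprn_ge0// ?expR_ge0// normc_ge0.
Qed.

(** The identities of n^{-s} = exp(- s ln n) come from those of cexp. *)
Lemma npow_oppE n s : npow_opp n s = cexp (- ((ln n%:R)%:C%C * s)).
Proof.
rewrite /npow_opp /cexp; congr (_ * _).
  by rewrite cReN cReZ mulrC.
by rewrite cImN cImM/= mul0r addr0 mulrC cosN sinN.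
Qed.

Lemma npow_oppD n s t : npow_opp n (s + t) = npow_opp n s * npow_opp n t.
Proof. by rewrite !npow_oppE mulrDr opprD cexpD. Qed.

Lemma npow_oppM m n s : (0 < m)%N -> (0 < n)%N ->
  npow_opp (m * n) s = npow_opp m s * npow_opp n s.
Proof.
move=> m0 n0; rewrite !npow_oppE natrM lnM ?posrE ?ltr0n//.
by rewrite rmorphD mulrDl opprD cexpD.
Qed.

Lemma npow_opp1 s : npow_opp 1 s = 1.
Proof. by rewrite npow_oppE ln1 mul0r oppr0 cexp0. Qed.

Lemma cnorm_npow_opp n s : cnorm (npow_opp n s) = expR (- (ln n%:R * Re s)).
Proof. by rewrite npow_oppE cnorm_cexp cReN cReZ. Qed.

Lemma ln_nat_ge0 n : 0 <= ln n%:R :> R.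
Proof. by case: n => [|n]; [rewrite ln0|apply: ln_ge0; rewrite ler1n]. Qed.

Lemma cnorm_npow_opp_le n s r : r <= Re s ->
  cnorm (npow_opp n s) <= expR (- (ln n%:R * r)).
Proof. by move=> h; rewrite cnorm_npow_opp ler_expR lerN2 ler_wpM2l//; exact: ln_nat_ge0. Qed.

Lemma cnorm_npow_opp_le1 n s : 0 <= Re s -> cnorm (npow_opp n s) <= 1.
Proof.
by move=> h; rewrite cnorm_npow_opp expR_le1 oppr_le0 mulr_ge0// ln_nat_ge0.
Qed.

Lemma npow_opp_dist_le n s t r : r <= Re s -> r <= Re t ->
  cnorm (npow_opp n s - npow_opp n t) <=
  2 * expR (- (ln n%:R * r)) * (ln n%:R * cnorm (s - t)).
Proof.
move=> rs rt; rewrite !npow_oppE.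
apply: le_trans (@cexp_dist_le _ _ (- (ln n%:R * r)) _ _) _.
- by rewrite cReN cReZ lerN2 ler_wpM2l//; exact: ln_nat_ge0.
- by rewrite cReN cReZ lerN2 ler_wpM2l//; exact: ln_nat_ge0.
rewrite -opprD -mulrBr normcN Normc.normcM cnorm_real.
by rewrite (ger0_norm (ln_nat_ge0 n)).
Qed.

End ComplexExponential.

(** * Uniform limits of Dirichlet polynomials *)

Section DirichletPolynomials.
Context {R : realType}.
Implicit Types (a b c : nat -> R[i]) (s : R[i]) (g p q : R[i] -> R[i]) (e : R).
Local Notation cnorm := (@Normc.normc R).
Local Notation Re := (@complex.Re R).
Local Notation Im := (@complex.Im R).

(** Dirichlet polynomials up to pointwise equality, so that sums and products need
no canonical choice of the coefficients and of the length. *)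
Definition dpoly p := exists a N, forall s, p s = dirichlet_partial a N s.

(** Brings two Dirichlet polynomials to the same length. *)
Lemma dirichlet_partial_widen a N M s : (N <= M)%N ->
  dirichlet_partial a N s =
  dirichlet_partial (fun n => if (n <= N)%N then a n else 0) M s.
Proof.
move=> NM; rewrite /dirichlet_partial (@big_cat_nat _ _ _ N.+1 _ M.+1)//=.
rewrite [X in _ + X]big1_seq ?addr0; last first.
  by move=> n /=; rewrite mem_index_iota => /andP[Nn _]; rewrite leqNgt Nn mul0r.
by rewrite !big_nat; apply: eq_bigr => n /andP[_]; rewrite ltnS => ->.
Qed.

Lemma dpolyD p q : dpoly p -> dpoly q -> dpoly (fun s => p s + q s).
Proof.
move=> [a [N pE]] [b [M qE]].
exists (fun n => (if (n <= N)%N then a n else 0) +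
                 (if (n <= M)%N then b n else 0)), (maxn N M) => s.
rewrite pE qE (dirichlet_partial_widen _ _ (leq_maxl N M)).
rewrite (dirichlet_partial_widen _ _ (leq_maxr N M)) -big_split/=.
by apply: eq_bigr => n _; rewrite mulrDl.
Qed.

Lemma dpolyZ k p : dpoly p -> dpoly (fun s => k * p s).
Proof.
move=> [a [N pE]]; exists (fun n => k * a n), N => s.
by rewrite pE /dirichlet_partial mulr_sumr; apply: eq_bigr => n _; rewrite mulrA.
Qed.

Lemma dpoly_npow n : (0 < n)%N -> dpoly (npow_opp n).
Proof.
case: n => // n _; exists (fun k => (k == n.+1)%:R), n.+1 => s.
rewrite /dirichlet_partial big_nat_recr//= eqxx mul1r big1_seq ?add0r// => k /=.
by rewrite mem_index_iota ltnS => /andP[_ kn]; rewrite ltn_eqF ?mul0r.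
Qed.

Lemma dpoly_ext p q : (forall s, p s = q s) -> dpoly p -> dpoly q.
Proof. by move=> pq [a [N h]]; exists a, N => s; rewrite -pq. Qed.

Lemma dpoly_cst k : dpoly (fun=> k).
Proof.
apply: dpoly_ext (dpolyZ k (@dpoly_npow 1 isT)) => s.
by rewrite npow_opp1 mulr1.
Qed.

Lemma dpoly_sum (r : seq nat) (P : pred nat) (F : nat -> R[i] -> R[i]) :
  {in r, forall n, P n -> dpoly (F n)} ->
  dpoly (fun s => \sum_(n <- r | P n) F n s).
Proof.
elim: r => [|n r IH] h.
  by apply: dpoly_ext (dpoly_cst 0) => s; rewrite big_nil.
have {}IH : dpoly (fun s => \sum_(n <- r | P n) F n s).
  by apply: IH => k kr; apply: h; rewrite inE kr orbT.
have [Pn|Pn] := boolP (P n).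
  apply: dpoly_ext (dpolyD (h n _ Pn) IH); last by rewrite inE eqxx.
  by move=> s; rewrite big_cons Pn.
by apply: dpoly_ext IH => s; rewrite big_cons (negbTE Pn).
Qed.

Lemma dpoly_partial a N : dpoly (dirichlet_partial a N).
Proof. by exists a, N. Qed.

Lemma dpolyM p q : dpoly p -> dpoly q -> dpoly (fun s => p s * q s).
Proof.
move=> [a [N pE]] [b [M qE]].
apply: (@dpoly_ext (fun s => \sum_(1 <= n < N.+1) \sum_(1 <= m < M.+1)
    (a n * b m) * npow_opp (n * m) s)) => [s|].
  rewrite pE qE /dirichlet_partial mulr_suml !big_nat; apply: eq_bigr => n.
  move=> /andP[n0 _]; rewrite mulr_sumr !big_nat; apply: eq_bigr => m.
  by move=> /andP[m0 _]; rewrite npow_oppM// mulrACA.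
apply: dpoly_sum => n; rewrite mem_index_iota => /andP[n0 _] _.
apply: dpoly_sum => m; rewrite mem_index_iota => /andP[m0 _] _.
by apply/dpolyZ/dpoly_npow; rewrite muln_gt0 n0.
Qed.

Lemma dpoly_bounded p : dpoly p ->
  exists2 M : R, 0 <= M & forall s, 0 <= Re s -> cnorm (p s) <= M.
Proof.
move=> [a [N pE]]; exists (\sum_(1 <= n < N.+1) cnorm (a n)).
  by apply: sumr_ge0 => n _; exact: normc_ge0.
move=> s s0; rewrite pE /dirichlet_partial.
apply: le_trans (cnorm_sum _ _ _) _.
apply: ler_sum => n _; rewrite Normc.normcM.
by rewrite ler_piMr ?normc_ge0// cnorm_npow_opp_le1.
Qed.

(** The functions on C_e that are uniformly almost periodic with frequencies ln n:
the uniform closure of the Dirichlet polynomials.  Partial sums of one series are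
not required, which makes the class stable under products, exponentials and
compositions. *)
Definition uap e g := forall d : R, 0 < d ->
  exists2 p, dpoly p & forall s, e < Re s -> cnorm (g s - p s) <= d.

Lemma uap_dpoly e p : dpoly p -> uap e p.
Proof. by move=> h d d0; exists p => // s _; rewrite subrr Normc.normc0 ltW. Qed.

Lemma uap_ext e g h : (forall s, e < Re s -> g s = h s) -> uap e g -> uap e h.
Proof.
move=> gh ug d d0; have [p dp hp] := ug d d0; exists p => // s es.
by rewrite -gh// hp.
Qed.

Lemma uap_closed e g : (forall d : R, 0 < d -> exists2 h, uap e h &
    forall s, e < Re s -> cnorm (g s - h s) <= d) -> uap e g.
Proof.
move=> H d d0; have d20 : 0 < d / 2 by rewrite divr_gt0.
have [h uh hgh] := H _ d20; have [p dp hp] := uh _ d20; exists p => // s es.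
apply: le_trans (cdistD (h s) _ _) _; rewrite (splitr d).
by rewrite lerD// ?hgh// hp.
Qed.

Lemma uapD e g h : uap e g -> uap e h -> uap e (fun s => g s + h s).
Proof.
move=> ug uh d d0; have d20 : 0 < d / 2 by rewrite divr_gt0.
have [p dp hp] := ug _ d20; have [q dq hq] := uh _ d20.
exists (fun s => p s + q s); first exact: dpolyD.
move=> s es; rewrite opprD addrACA; apply: le_trans (le_normcD _ _) _.
by rewrite (splitr d) lerD// ?hp// hq.
Qed.

Lemma uap_bounded e g : 0 <= e -> uap e g ->
  exists2 M : R, 0 < M & forall s, e < Re s -> cnorm (g s) <= M.
Proof.
move=> e0 /(_ 1 ltr01)[p dp hp]; have [M M0 hM] := dpoly_bounded dp.
exists (1 + M); first by rewrite ltr_pwDl.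
move=> s es; apply: le_trans (cnorm_ler_dist _ (p s)) _.
by rewrite lerD ?hp// hM// ltW// (le_lt_trans e0).
Qed.

(** Uses that uniform limits of Dirichlet polynomials are bounded, whence e >= 0. *)
Lemma uapM e g h : 0 <= e -> uap e g -> uap e h -> uap e (fun s => g s * h s).
Proof.
move=> e0 ug uh d d0; have [M M0 hM] := uap_bounded e0 ug.
have dM : 0 < d / 2 / M by rewrite !divr_gt0.
have [q dq hq] := uh _ dM.
have [K K0 hK] := dpoly_bounded dq.
have dK : 0 < d / 2 / (K + 1) by rewrite !divr_gt0// ltr_wpDl.
have [p dp hp] := ug _ dK.
exists (fun s => p s * q s); first exact: dpolyM.
move=> s es.
have -> : g s * h s - p s * q s = g s * (h s - q s) + (g s - p s) * q s by ring.
apply: le_trans (le_normcD _ _) _; rewrite !Normc.normcM (splitr d) lerD//.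
  rewrite [leRHS](_ : _ = M * (d / 2 / M)); last by field; rewrite gt_eqF.
  by apply: ler_pM; rewrite ?normc_ge0 ?hM ?hq.
rewrite [leRHS](_ : _ = (d / 2 / (K + 1)) * (K + 1)); last first.
  by rewrite divfK// gt_eqF// ltr_wpDl.
apply: ler_pM; rewrite ?normc_ge0 ?hp//.
by rewrite (le_trans (hK _ _)) ?lerDl// ltW// (le_lt_trans e0).
Qed.

Lemma uapZ e k g : 0 <= e -> uap e g -> uap e (fun s => k * g s).
Proof. by move=> e0; apply: uapM => //; apply/uap_dpoly/dpoly_cst. Qed.

Lemma uap_cst e k : uap e (fun=> k).
Proof. exact/uap_dpoly/dpoly_cst. Qed.

Lemma uapX e g m : 0 <= e -> uap e g -> uap e (fun s => g s ^+ m).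
Proof.
move=> e0 ug; elim: m => [|m IH]; first exact: uap_cst.
by apply: uap_ext (uapM e0 ug IH) => s _; rewrite exprS.
Qed.

Lemma uap_cexp e g : 0 <= e -> uap e g -> uap e (fun s => cexp (g s)).
Proof.
move=> e0 ug; have [M M0 hM] := uap_bounded e0 ug.
apply: uap_closed => d d0.
pose K := 4 * M ^+ 2 * expR M.
have K0 : 0 <= K by rewrite mulr_ge0 ?expR_ge0// mulr_ge0// sqr_ge0.
have [m hm] : exists m : nat, M * 2 + K / d <= m.+1%:R.
  have := archi_boundP (x := M * 2 + K / d) _.
  move=> /(_ (addr_ge0 (mulr_ge0 (ltW M0) (ler0n _ _)) (divr_ge0 K0 (ltW d0)))) h.
  by exists (Num.bound (M * 2 + K / d)); rewrite (le_trans (ltW h))// ler_nat.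
exists (fun s => (1 + g s / m.+1%:R) ^+ m.+1).
  apply: uapX => //; apply: uapD; first exact: uap_cst.
  by apply: uapM => //; exact: uap_cst.
move=> s es; have gM := hM _ es.
apply: le_trans (cexp_powers _) _.
  apply: le_trans gM _; rewrite ler_pdivlMr//; apply: le_trans hm.
  by rewrite lerDl divr_ge0// ltW.
rewrite ler_pdivrMr//; apply: (@le_trans _ _ K).
  have g2 : cnorm (g s) ^+ 2 <= M ^+ 2 by rewrite lerXn2r// nnegrE ?normc_ge0// ltW.
  apply: ler_pM; rewrite ?expR_ge0 ?ler_expR//; last by rewrite ler_pM2l.
  by rewrite mulr_ge0// sqr_ge0.
rewrite mulrC -ler_pdivrMr//; apply: le_trans hm.
by rewrite lerDr mulr_ge0// ltW.
Qed.

(** n^{-rho(s)} = n^{-s} exp(- ln n (rho(s) - s)). *)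
Lemma uap_npow_comp e n rho : 0 <= e -> (0 < n)%N ->
  uap e (fun s => rho s - s) -> uap e (fun s => npow_opp n (rho s)).
Proof.
move=> e0 n0 urho.
have u1 : uap e (fun s => cexp (- ((ln n%:R)%:C%C * (rho s - s)))).
  apply: uap_cexp => //.
  apply: uap_ext (uapZ (- (ln n%:R)%:C%C) e0 urho) => s _.
  by rewrite mulNr.
apply: uap_ext (uapM e0 (uap_dpoly e (dpoly_npow n0)) u1) => s _.
by rewrite -npow_oppE -npow_oppD addrC subrK.
Qed.

(** Approximate chi by a Dirichlet polynomial and use uap_npow_comp on each term. *)
Lemma uap_comp e e' chi rho : 0 <= e -> uap e' chi ->
  uap e (fun s => rho s - s) -> (forall s, e < Re s -> e' < Re (rho s)) ->
  uap e (fun s => chi (rho s)).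
Proof.
move=> e0 uchi urho hrho; apply: uap_closed => d d0.
have [p dp hp] := uchi d d0; exists (fun s => p (rho s)); last first.
  by move=> s es; rewrite hp// hrho.
have [a [N pE]] := dp.
apply: (@uap_ext _ (fun s => \sum_(1 <= n < N.+1) a n * npow_opp n (rho s))).
  by move=> s _; rewrite pE.
rewrite /index_iota.
have : all (fun n => (0 < n)%N) (iota 1 (N.+1 - 1)).
  by apply/allP => n; rewrite mem_iota => /andP[].
elim: (iota _ _) => [_|n r IH /= /andP[n0 r0]].
  by apply: uap_ext (uap_cst e 0) => s _; rewrite big_nil.
apply: uap_ext (uapD (uapZ (a n) e0 (uap_npow_comp e0 n0 urho)) (IH r0)) => s _.
by rewrite big_cons.
Qed.

End DirichletPolynomials.

(** * Mean values on vertical lines *)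

Section MeanValues.
Context {R : realType}.
Implicit Types (a b c : nat -> R[i]) (s w x y z : R[i]) (p q : R[i] -> R[i]).
Implicit Types (F G : R -> R[i]) (sg t : R).
Local Notation cnorm := (@Normc.normc R).
Local Notation Re := (@complex.Re R).
Local Notation Im := (@complex.Im R).

Lemma uniform_dirichlet_expansion c psi (e : R) : dirichlet_expansion c psi ->
  0 < e -> forall d : R, 0 < d -> exists N, forall n, (N <= n)%N ->
    forall s, e < Re s -> cnorm (psi s - dirichlet_partial c n s) <= d.
Proof.
move=> h e0 d d0.
have d0' : 0 < (d%:C)%C by rewrite ltcR.
have := h e e0; move=> /(_ [set f | forall s, e < Re s ->
    ball (psi s) (d%:C)%C (f s)]).
case.
  apply/uniform_nbhs; exists [set xy | ball xy.1 (d%:C)%C xy.2]; split.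
    exact: (@entourage_ball _ _ (PosNum d0')).
  by move=> f /= hf s es; exact: hf.
move=> N _ hN; exists N => n Nn s es.
have := hN n Nn s es.
rewrite -ball_normE /= => /ltW.
by rewrite -[leLHS]/((cnorm (psi s - dirichlet_partial c n s))%:C)%C lecR.
Qed.

Lemma uap_expansion c psi (e : R) : dirichlet_expansion c psi -> 0 < e ->
  uap e psi.
Proof.
move=> h e0 d d0; have [N hN] := uniform_dirichlet_expansion h e0 d0.
by exists (dirichlet_partial c N); [exact: dpoly_partial|exact: hN].
Qed.

Lemma cexp_real (r : R) : cexp r%:C%C = (expR r)%:C%C.
Proof. by rewrite /cexp/= cos0 sin0 mulr1. Qed.

Definition cis (t : R) : R[i] := cexp (0 +i* t)%C.

Lemma cisD t u : cis (t + u) = cis t * cis u.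
Proof. by rewrite /cis -cexpD; congr cexp; apply/eqP; rewrite eq_complex/= addr0 !eqxx. Qed.

Lemma cis_pi : cis pi = -1.
Proof.
by rewrite /cis /cexp/= expR0 cospi sinpi mul1r; apply/eqP; rewrite eq_complex/= oppr0 !eqxx.
Qed.

(** Trigonometric polynomials without constant term. *)
Definition osc F := exists2 l : seq (R[i] * R), all (fun u => u.2 != 0) l &
  forall t, F t = \sum_(u <- l) u.1 * cis (u.2 * t).

(** A nonnegative trigonometric polynomial has a nonnegative constant term.  By
induction on the number of frequencies: with tau = pi / lam, the average of F(t)
and F(t + tau) has the same constant term, is still nonnegative, and no longer
contains the frequency lam since exp(i lam tau) = -1. *)
Lemma osc_mean F (k : R) : osc F -> (forall t, 0 <= k + Re (F t)) -> 0 <= k.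
Proof.
move=> [l]; move: {2}(size l) (leqnn (size l)) => n.
elim: n l F => [|n IH] [|[a lam] l] F //= ln.
- by move=> _ hF /(_ 0); rewrite hF big_nil addr0.
- by move=> _ hF /(_ 0); rewrite hF big_nil addr0.
move=> /andP[lam0 hl] hF F0.
pose tau := pi / lam.
(* The frequency lam of the head has cancelled; the others keep theirs. *)
pose l' := [seq (u.1 * (1 + cis (u.2 * tau)) / 2, u.2) | u <- l].
apply: (IH l' (fun t => (F t + F (t + tau)) / 2)).
- by rewrite size_map.
- by rewrite all_map; apply: sub_all hl.
- move=> t; rewrite !hF !big_cons/= mulrDr (mulrC lam tau) divfK//.
  rewrite cisD cis_pi mulrN1 mulrN addrACA subrr add0r -big_split/=.
  rewrite big_map mulr_suml; apply: eq_bigr => u _ /=.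
  by rewrite mulrDr cisD; ring.
- move=> t; have := F0 t; have := F0 (t + tau).
  have -> : (F t + F (t + tau)) / 2 = ((2^-1)%:C)%C * (F t + F (t + tau)).
    by rewrite mulrC rmorphV ?unitfE// rmorph_nat.
  rewrite cReZ cReD; lra.
Qed.

Lemma osc_ext F G : F =1 G -> osc F -> osc G.
Proof. by move=> /funext ->. Qed.

Lemma osc_cis (k : R[i]) (lam : R) : lam != 0 -> osc (fun t => k * cis (lam * t)).
Proof. by move=> l0; exists [:: (k, lam)]; rewrite /= ?l0// => t; rewrite big_seq1. Qed.

Lemma osc0 : osc (fun=> 0).
Proof. by exists [::] => // t; rewrite big_nil. Qed.

Lemma oscD F G : osc F -> osc G -> osc (fun t => F t + G t).
Proof.
move=> [l hl hF] [m hm hG]; exists (l ++ m); first by rewrite all_cat hl.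
by move=> t; rewrite big_cat hF hG.
Qed.

Lemma osc_sum (r : seq nat) (P : pred nat) (H : nat -> R -> R[i]) :
  {in r, forall n, P n -> osc (H n)} ->
  osc (fun t => \sum_(n <- r | P n) H n t).
Proof.
elim: r => [|n r IH] h.
  by apply: osc_ext osc0 => t; rewrite big_nil.
have {}IH : osc (fun t => \sum_(n <- r | P n) H n t).
  by apply: IH => k kr; apply: h; rewrite inE kr orbT.
have [Pn|Pn] := boolP (P n).
  apply: osc_ext (oscD (h n _ Pn) IH); last by rewrite inE eqxx.
  by move=> s; rewrite big_cons Pn.
by apply: osc_ext IH => s; rewrite big_cons (negbTE Pn).
Qed.

(** The uniform closure of osc; it stands for the almost periodic functions with mean
value zero, no mean value being computed. *)
Definition null_mean G := forall d : R, 0 < d ->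
  exists2 F, osc F & forall t, cnorm (G t - F t) <= d.

Lemma null_mean_osc F : osc F -> null_mean F.
Proof. by move=> oF d d0; exists F => // t; rewrite subrr Normc.normc0 ltW. Qed.

Lemma null_mean_ext F G : F =1 G -> null_mean F -> null_mean G.
Proof. by move=> /funext ->. Qed.

Lemma null_mean_ge0 G (k : R) :
  null_mean G -> (forall t, 0 <= k + Re (G t)) -> 0 <= k.
Proof.
move=> nG G0; apply/ler_addgt0Pr => d d0; have [F oF hF] := nG d d0.
apply: (osc_mean oF) => t; apply: le_trans (G0 t) _.
rewrite -addrA lerD2l -lerBlDr -cReB.
by apply: le_trans (hF t); apply: le_trans (cRe_le_cnorm _); exact: ler_norm.
Qed.

Lemma null_meanD F G : null_mean F -> null_mean G -> null_mean (fun t => F t + G t).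
Proof.
move=> nF nG d d0; have d20 : 0 < d / 2 by rewrite divr_gt0.
have [f of' hf] := nF _ d20; have [g og hg] := nG _ d20.
exists (fun t => f t + g t); first exact: oscD.
move=> t; rewrite opprD addrACA; apply: le_trans (le_normcD _ _) _.
by rewrite (splitr d) lerD.
Qed.

Lemma oscZ k F : osc F -> osc (fun t => k * F t).
Proof.
move=> [l hl hF]; exists [seq (k * u.1, u.2) | u <- l].
  by rewrite all_map; apply: sub_all hl.
move=> t; rewrite hF big_map mulr_sumr; apply: eq_bigr => u _ /=.
by rewrite mulrA.
Qed.

Lemma null_meanZ k F : null_mean F -> null_mean (fun t => k * F t).
Proof.
move=> nF d d0.
have k0 : 0 < cnorm k + 1 by rewrite ltr_wpDl// normc_ge0.
have dk0 : 0 < d / (cnorm k + 1) by rewrite divr_gt0.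
have [f of' hf] := nF _ dk0; exists (fun t => k * f t); first exact: oscZ.
move=> t; rewrite -mulrBr Normc.normcM.
rewrite [leRHS](_ : _ = (cnorm k + 1) * (d / (cnorm k + 1))); last first.
  by rewrite mulrC divfK// gt_eqF.
by apply: ler_pM; rewrite ?normc_ge0// lerDl.
Qed.

Lemma null_mean_sum (r : seq nat) (P : pred nat) (H : nat -> R -> R[i]) :
  {in r, forall n, P n -> null_mean (H n)} ->
  null_mean (fun t => \sum_(n <- r | P n) H n t).
Proof.
elim: r => [|n r IH] h.
  by apply: null_mean_ext (null_mean_osc osc0) => t; rewrite big_nil.
have {}IH : null_mean (fun t => \sum_(n <- r | P n) H n t).
  by apply: IH => k kr; apply: h; rewrite inE kr orbT.
have [Pn|Pn] := boolP (P n).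
  apply: null_mean_ext (null_meanD (h n _ Pn) IH); last by rewrite inE eqxx.
  by move=> s; rewrite big_cons Pn.
by apply: null_mean_ext IH => s; rewrite big_cons (negbTE Pn).
Qed.

Lemma cRe_mulJ x : Re (x * (x^*)%C) = cnorm x ^+ 2.
Proof. by rewrite cnorm_sqr; case: x => u v /=; ring. Qed.

Lemma cexpJ z : ((cexp z)^*)%C = cexp (z^*)%C.
Proof.
case: z => u v; rewrite /cexp/= cosN sinN; apply/eqP; rewrite eq_complex/=.
by apply/andP; split; apply/eqP; ring.
Qed.

Lemma cJM x y : ((x * y)^*)%C = (x^*)%C * (y^*)%C.
Proof. exact: rmorphM. Qed.

Lemma cJ_real (r : R) : ((r%:C)^*)%C = (r%:C)%C.
Proof. by rewrite /= oppr0. Qed.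

Lemma cJ_cis t : ((cis t)^*)%C = cis (- t).
Proof. by rewrite /cis cexpJ. Qed.

Lemma npow_opp_line n sg t :
  npow_opp n (sg +i* t)%C = (expR (- (ln n%:R * sg)))%:C%C * cis (- (ln n%:R * t)).
Proof.
rewrite npow_oppE /cis /cexp cReN cReZ cImN cImM/= expR0 mul0r addr0 mul1r.
by [].
Qed.

(** The mean of |sum a_n n^{-s}|^2 over the line Re s = sg. *)
Definition wsqnorm (sg : R) a (N : nat) : R :=
  \sum_(1 <= n < N.+1) (cnorm (a n) * expR (- (ln n%:R * sg))) ^+ 2.

(** Expanding the square, the diagonal is constant on the line, and the term of index
(n, m) has the frequency ln m - ln n, which is nonzero for m <> n. *)
Lemma osc_sqnorm_partial a N sg : exists2 F, osc F &
  forall t, cnorm (dirichlet_partial a N (sg +i* t)%C) ^+ 2 =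
            wsqnorm sg a N + Re (F t).
Proof.
pose x n t := a n * npow_opp n (sg +i* t)%C.
exists (fun t => \sum_(1 <= n < N.+1) \sum_(1 <= m < N.+1 | m != n)
    x n t * ((x m t)^*)%C).
  apply: osc_sum => n; rewrite mem_index_iota => /andP[n0 _] _.
  apply: osc_sum => m; rewrite mem_index_iota => /andP[m0 _] mn.
  pose k := a n * ((a m)^*)%C *
    (expR (- (ln n%:R * sg)) * expR (- (ln m%:R * sg)))%:C%C.
  have lnm : ln m%:R - ln n%:R != 0 :> R.
    rewrite subr_eq0; apply: contra mn => /eqP/ln_inj; rewrite !posrE !ltr0n.
    by move=> /(_ m0 n0)/eqP; rewrite eqr_nat.
  apply: osc_ext (osc_cis k lnm) => t.
  rewrite /x !npow_opp_line /k 2!cJM cJ_real cJ_cis opprK mulrBl cisD rmorphM/=.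
  by ring.
move=> t; rewrite /dirichlet_partial -cRe_mulJ rmorph_sum/= mulr_suml.
rewrite /wsqnorm !cRe_sum -big_split/= big_nat [RHS]big_nat; apply: eq_bigr => n.
move=> nN; rewrite mulr_sumr (bigD1_seq n)/= ?mem_index_iota ?iota_uniq//.
rewrite cReD cRe_mulJ Normc.normcM cnorm_npow_opp/=; congr (_ + Re _).
Qed.

(** Summation by parts: with S_n the sum of the b_m for n <= m < N, the term of index n on
the right is r_n (|S_n|^2 - |S_{n+1}|^2), so the right-hand side exceeds the
left-hand side by the sum of the (r_{n+1} - r_n) |S_{n+1}|^2 >= 0. *)
Lemma sqnorm_sum_le (b : nat -> R[i]) (r : nat -> R) k N :
  (forall n, (k <= n)%N -> r n <= r n.+1) -> (forall n, 0 <= r n) -> (k <= N)%N ->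
  r k * cnorm (\sum_(k <= n < N) b n) ^+ 2 <=
  \sum_(k <= n < N) r n * (cnorm (b n) ^+ 2 +
     2 * Re (((b n)^*)%C * \sum_(n.+1 <= m < N) b m)).
Proof.
move=> + r0 kN; rewrite -(subnKC kN); move: (N - k)%N => {kN}d.
elim: d k => [|d IH] k rk.
  by rewrite addn0 !big_geq// Normc.normc0 expr0n mulr0.
rewrite addnS -addSn big_ltn ?ltn_addr// [leRHS]big_ltn ?ltn_addr//.
have rk' n : (k.+1 <= n)%N -> r n <= r n.+1 by move=> /ltnW; exact: rk.
have := IH k.+1 rk'; set S := \sum_(k.+1 <= m < _) b m => hS.
apply: (@le_trans _ _ (r k * (cnorm (b k) ^+ 2 + 2 * Re (((b k)^*)%C * S)) +
   r k.+1 * cnorm S ^+ 2)); last by rewrite lerD2l.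
have -> : cnorm (b k + S) ^+ 2 =
   cnorm (b k) ^+ 2 + 2 * Re (((b k)^*)%C * S) + cnorm S ^+ 2.
  by rewrite !cnorm_sqr; case: (b k) (S) => [u v] [u' v'] /=; ring.
by rewrite mulrDr lerD2l ler_wpM2r ?sqr_ge0 ?rk.
Qed.

(** The function on the right is the harmonic function of w in the right half-plane with
boundary values |f|^2 on the imaginary axis, and |f|^2 is subharmonic.  The proof is
algebraic: sqnorm_sum_le with b_n = a_n n^{-w} and r_n = n^{2 Re w}. *)
Lemma sqnorm_dirichlet_partial_le a N w : 0 <= Re w ->
  cnorm (dirichlet_partial a N w) ^+ 2 <=
  \sum_(1 <= n < N.+1) cnorm (a n) ^+ 2 +
  Re (2 * \sum_(1 <= n < N.+1) \sum_(n.+1 <= m < N.+1)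
     (a m * ((a n)^*)%C) * cexp (- ((ln m%:R - ln n%:R)%:C%C * w))).
Proof.
move=> w0.
pose r n : R := expR (2 * (ln n%:R * Re w)).
have := @sqnorm_sum_le (fun n => a n * npow_opp n w) r 1 N.+1 _ _ isT.
have r1 : r 1%N = 1 by rewrite /r ln1 mul0r mulr0 expR0.
rewrite r1 mul1r => h; apply: le_trans (h _ _) _ => {h}.
- move=> n n0; rewrite ler_expR ler_pM2l// ler_wpM2r// ler_ln ?posrE ?ltr0n//.
  by rewrite ler_nat.
- by move=> n; exact: expR_ge0.
have -> : Re (2 * \sum_(1 <= n < N.+1) \sum_(n.+1 <= m < N.+1)
     (a m * ((a n)^*)%C) * cexp (- ((ln m%:R - ln n%:R)%:C%C * w))) =
  \sum_(1 <= n < N.+1) 2 * \sum_(n.+1 <= m < N.+1)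
   Re ((a m * ((a n)^*)%C) * cexp (- ((ln m%:R - ln n%:R)%:C%C * w))).
  rewrite -(rmorph_nat (real_complex R)) cReZ cRe_sum mulr_sumr.
  by apply: eq_bigr => n _; rewrite cRe_sum.
rewrite -big_split/=; apply: ler_sum => n _; rewrite mulrDr; apply: lerD.
  rewrite Normc.normcM cnorm_npow_opp exprMn -expRM_natl /r mulrCA -expRD.
  by rewrite mulrN subrr expR0 mulr1.
rewrite mulrCA ler_pM2l// mulr_sumr cRe_sum mulr_sumr.
apply: ler_sum => m _; rewrite -cReZ le_eqVlt; apply/orP; left; apply/eqP.
congr Re; rewrite /r -cexp_real cJM !npow_oppE cexpJ.
rewrite [LHS](_ : _ = a m * ((a n)^*)%C * (cexp (2 * (ln n%:R * Re w))%:C%C *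
   cexp ((- ((ln n%:R)%:C%C * w))^*)%C * cexp (- ((ln m%:R)%:C%C * w)))); last ring.
rewrite -!cexpD; congr (_ * cexp _); apply/eqP; rewrite eq_complex.
by clear r r1; case: w {w0} => u v /=; apply/andP; split; apply/eqP; ring.
Qed.

End MeanValues.

(** * Composition does not increase mean squares *)

Section Contraction.
Context {R : realType}.
Implicit Types (a b c : nat -> R[i]) (s w x y z : R[i]) (p q phi : R[i] -> R[i]).
Implicit Types (sg t : R).
Local Notation cnorm := (@Normc.normc R).
Local Notation Re := (@complex.Re R).
Local Notation Im := (@complex.Im R).

(** exp(- mu phi(s)) = exp(- mu s) exp(- mu (phi(s) - s)), where the second factor is a
uniform limit of Dirichlet polynomials; all the frequencies mu + ln n of the product
are positive. *)
Lemma null_mean_cexp_line (mu sg sg' : R) phi : 0 < mu -> 0 <= sg -> sg < sg' ->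
  uap sg (fun s => phi s - s) ->
  null_mean (fun t => cexp (- (mu%:C%C * phi (sg' +i* t)%C))).
Proof.
move=> mu0 sg0 sgs uphi.
have u : uap sg (fun s => cexp (- (mu%:C%C * (phi s - s)))).
  apply: uap_cexp => //.
  by apply: uap_ext (uapZ (- mu%:C%C) sg0 uphi) => s _; rewrite mulNr.
move=> d d0; have [p [a [N pE]] hp] := u d d0.
exists (fun t => cexp (- (mu%:C%C * (sg' +i* t)%C)) * p (sg' +i* t)%C); last first.
  move=> t; set s := (sg' +i* t)%C.
  have -> : cexp (- (mu%:C%C * phi s)) =
    cexp (- (mu%:C%C * s)) * cexp (- (mu%:C%C * (phi s - s))).
    by rewrite -cexpD; congr cexp; ring.
  rewrite -mulrBr Normc.normcM cnorm_cexp cReN cReZ.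
  apply: le_trans (hp s _) => //.
  rewrite ler_piMl ?normc_ge0// expR_le1 oppr_le0 mulr_ge0//; first exact: ltW.
  by rewrite ltW// (le_lt_trans sg0).
apply: (@osc_ext _ (fun t => \sum_(1 <= n < N.+1)
   (a n * (expR (- ((mu + ln n%:R) * sg')))%:C%C) * cis (- (mu + ln n%:R) * t))).
  move=> t; rewrite pE /dirichlet_partial mulr_sumr; apply: eq_bigr => n _.
  rewrite (mulrCA _ (a n)) -(mulrA (a n)); congr (a n * _); rewrite npow_oppE -cexpD.
  rewrite -cexp_real /cis -cexpD; congr cexp; apply/eqP; rewrite eq_complex/=.
  by apply/andP; split; apply/eqP; ring.
apply: osc_sum => n _ _; apply: osc_cis.
by rewrite oppr_eq0 gt_eqF// ltr_wpDr// ln_nat_ge0.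
Qed.

(** The mean of |f o phi|^2 is at most the squared norm of f, in a form that bears on a
Dirichlet polynomial d-close to f o phi.  Since |P| <= |f o phi| + d, one has
|P|^2 <= (1 + d) |f o phi|^2 + d + d^2; this error does not involve the supremum of
|f o phi|, and that matters when f runs through the partial sums of an element of H^2. *)
Lemma wsqnorm_comp_le a N b M phi (sg sg' d : R) : 0 <= sg -> sg < sg' -> 0 <= d ->
  uap sg (fun s => phi s - s) -> (forall s, sg < Re s -> 0 <= Re (phi s)) ->
  (forall s, sg < Re s ->
    cnorm (dirichlet_partial a N (phi s) - dirichlet_partial b M s) <= d) ->
  wsqnorm sg' b M <=
    (1 + d) * \sum_(1 <= n < N.+1) cnorm (a n) ^+ 2 + d + d ^+ 2.
Proof.
move=> sg0 sgs d0 uphi phi0 hab.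
have [F oF hF] := osc_sqnorm_partial b M sg'.
pose H t := 2 * \sum_(1 <= n < N.+1) \sum_(n.+1 <= m < N.+1)
     (a m * ((a n)^*)%C) * cexp (- ((ln m%:R - ln n%:R)%:C%C * phi (sg' +i* t)%C)).
have nH : null_mean H.
  apply: null_meanZ; apply: null_mean_sum => n; rewrite mem_index_iota.
  move=> /andP[n0 _] _; apply: null_mean_sum => m; rewrite mem_index_iota.
  move=> /andP[nm _] _; apply: null_meanZ; apply: null_mean_cexp_line uphi => //.
  by rewrite subr_gt0 ltr_ln ?posrE ?ltr0n ?ltr_nat// (ltn_trans _ nm).
have nG := null_meanD (null_meanZ (1 + d)%:C%C nH) (null_meanZ (-1) (null_mean_osc oF)).
rewrite -subr_ge0; apply: (null_mean_ge0 nG) => t.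
rewrite cReD cReZ mulN1r cReN.
set s := (sg' +i* t)%C; have ss : sg < Re s by [].
have := sqnorm_dirichlet_partial_le a N (phi0 s ss); rewrite -/(H t).
have := hF t; have := hab s ss; rewrite -/s.
have := cnorm_ler_dist (dirichlet_partial b M s) (dirichlet_partial a N (phi s)).
rewrite (cdistC (dirichlet_partial b M s)).
have := normc_ge0 (dirichlet_partial b M s).
have := normc_ge0 (dirichlet_partial a N (phi s)).
have := normc_ge0 (dirichlet_partial a N (phi s) - dirichlet_partial b M s).
move: (cnorm _) (cnorm _) (cnorm _) => z y x x0 y0 z0 h1 h2 h3 h4.
have zyd : z <= y + d by lra.
have z2 : z ^+ 2 <= (y + d) ^+ 2 by rewrite lerXn2r// nnegrE// addr_ge0.
have h5 : (1 + d) * y ^+ 2 <= (1 + d) * (\sum_(1 <= n < N.+1) cnorm (a n) ^+ 2 + Re (H t)).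
  by rewrite ler_pM2l// ltr_pwDl.
have h6 : d * (2 * y) <= d * (y ^+ 2 + 1).
  by rewrite ler_wpM2l//; have := sqr_ge0 (y - 1); nra.
move: h5 h3; rewrite mulrDr.
move: (\sum_(_ <= _ < _) _) (Re (F t)) (wsqnorm _ _ _) (Re (H t)) => S u v k h5 h3.
move: z2; rewrite h3; nra.
Qed.

End Contraction.

(** * Convergence of the series of H^2 *)

Section HardySpaceTheory.
Context {R : realType}.
Implicit Types (a b c : nat -> R[i]) (s w x y z : R[i]) (p q phi : R[i] -> R[i]).
Implicit Types (sg t : R) (f g : H2 R).
Local Notation cnorm := (@Normc.normc R).
Local Notation Re := (@complex.Re R).
Local Notation Im := (@complex.Im R).

Lemma ln_natS_diff n : (0 < n)%N -> n.+1%:R^-1 <= ln n.+1%:R - ln n%:R :> R.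
Proof.
move=> n0; have n0' : 0 < n%:R :> R by rewrite ltr0n.
rewrite -ln_div ?posrE// -[leRHS]opprK -lnV ?posrE ?divr_gt0// invf_div.
have -> : n%:R / n.+1%:R = 1 + (- n.+1%:R^-1) :> R.
  by rewrite -natr1; field; rewrite natr1 gt_eqF.
rewrite lerNr; apply: le_ln1Dx.
by rewrite ltrN2 invf_lt1// ltr1n ltnS.
Qed.

(** Comparison with a telescoping sum: writing q = th - 1, n^{-th} is at most
((n-1)^{-q} - n^{-q}) / q. *)
Lemma zeta_partial_le (th : R) : 1 < th ->
  exists2 Z : R, 0 < Z &
    forall N, \sum_(1 <= n < N.+1) expR (- (ln n%:R * th)) <= Z.
Proof.
move=> th1; have q0 : 0 < th - 1 by rewrite subr_gt0.
exists (1 + (th - 1)^-1); first by rewrite addr_gt0// invr_gt0.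
suff H N : \sum_(1 <= n < N.+2) expR (- (ln n%:R * th)) <=
    1 + (th - 1)^-1 - (th - 1)^-1 * expR (- (ln N.+1%:R * (th - 1))).
  move=> [|N]; first by rewrite big_geq// addr_ge0// invr_ge0 ltW.
  apply: le_trans (H N) _; rewrite gerBl mulr_ge0 ?expR_ge0// invr_ge0 ltW//.
elim: N => [|N IH].
  by rewrite big_nat1 ln1 !mul0r oppr0 expR0 mulr1 addrK.
rewrite big_nat_recr//=; apply: le_trans (lerD IH (lexx _)) _.
set L := ln N.+2%:R; set l := ln N.+1%:R.
suff h : expR (- (L * th)) <=
    (th - 1)^-1 * (expR (- (l * (th - 1))) - expR (- (L * (th - 1)))).
  by move: h; rewrite mulrBr; lra.
rewrite -ler_pdivrMl ?invr_gt0// invrK.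
have -> : expR (- (l * (th - 1))) =
    expR (- (L * (th - 1))) * expR ((L - l) * (th - 1)).
  by rewrite -expRD; congr expR; ring.
have -> : expR (- (L * th)) = expR (- (L * (th - 1))) * expR (- L).
  by rewrite -expRD; congr expR; ring.
rewrite mulrCA -[X in _ <= _ - X]mulr1 -mulrBr ler_wpM2l ?expR_ge0//.
have -> : expR (- L) = N.+2%:R^-1 by rewrite expRN lnK// posrE.
rewrite lerBrDl; apply: le_trans (expR_ge1Dx _).
by rewrite lerD2l mulrC ler_wpM2r ?(ltW q0)// ln_natS_diff.
Qed.

Lemma wsqnorm_ge0 sg a N : 0 <= wsqnorm sg a N.
Proof. by apply: sumr_ge0 => n _; exact: sqr_ge0. Qed.

(** The Cauchy-Schwarz inequality, summing x y <= x^2 / e + e y^2 with x = |a_n| n^{-sg}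
and y = n^{-th}. *)
Lemma dirichlet_partial_le_wsqnorm (th : R) : 2^-1 < th ->
  exists2 Z : R, 0 < Z & forall a N sg s (e : R), 0 < e ->
    wsqnorm sg a N <= e ^+ 2 -> sg + th <= Re s ->
    cnorm (dirichlet_partial a N s) <= e * Z.
Proof.
move=> th1; have th2 : 1 < 2 * th by rewrite -ltr_pdivrMl// mulr1.
have [Z Z0 hZ] := zeta_partial_le th2.
exists (1 + Z) => [|a N sg s e e0 ae sgs]; first by rewrite addr_gt0.
apply: le_trans (cnorm_sum _ _ _) _.
apply: (@le_trans _ _ (\sum_(1 <= n < N.+1)
  (e^-1 * (cnorm (a n) * expR (- (ln n%:R * sg))) ^+ 2 +
   e * expR (- (ln n%:R * (2 * th)))))).
  apply: ler_sum => n _; rewrite Normc.normcM.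
  have h1 : cnorm (npow_opp n s) <= expR (- (ln n%:R * sg)) * expR (- (ln n%:R * th)).
    rewrite -expRD -opprD -mulrDr; exact: cnorm_npow_opp_le.
  apply: le_trans (ler_wpM2l (normc_ge0 _) h1) _; rewrite (mulrA (cnorm (a n))).
  have -> : expR (- (ln n%:R * (2 * th))) = expR (- (ln n%:R * th)) ^+ 2.
    by rewrite -expRM_natl; congr expR; ring.
  have := mulr_ge0 (normc_ge0 (a n)) (expR_ge0 (- (ln n%:R * sg))).
  have := expR_ge0 (- (ln n%:R * th)); move: (_ * expR _) (expR _) => x y y0 x0.
  rewrite -(ler_pM2l e0) mulrDr (mulrA e e^-1) divff ?gt_eqF// mul1r.
  by have := sqr_ge0 (x - e * y); have := mulr_ge0 (mulr_ge0 (ltW e0) x0) y0; nra.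
rewrite big_split/= -!mulr_sumr mulrDr mulr1; apply: lerD; last first.
  by rewrite ler_pM2l.
by rewrite ler_pdivrMl// -expr2.
Qed.

Lemma wsqnorm0 a N : wsqnorm 0 a N = \sum_(1 <= n < N.+1) cnorm (a n) ^+ 2.
Proof. by apply: eq_bigr => n _; rewrite mulr0 oppr0 expR0 mulr1. Qed.

Lemma H2_series f N :
  series (fun n => cnorm (f n) ^+ 2) N.+1 = \sum_(1 <= n < N.+1) cnorm (f n) ^+ 2.
Proof.
have /H2_predP[f0 _] := H2_coefP f.
by rewrite /series/= big_ltn// f0 Normc.normc0 expr0n add0r.
Qed.

Lemma H2_wsqnorm_le f N : wsqnorm 0 f N <= H2_sqnorm f.
Proof.
rewrite wsqnorm0 -H2_series; apply: nondecreasing_cvgn_le; last exact: H2_cvg.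
by apply: nondecreasing_series => k _ _; exact: sqr_ge0.
Qed.

Lemma H2_sqnorm_le f (K : R) : (forall N, wsqnorm 0 f N <= K) -> H2_sqnorm f <= K.
Proof.
move=> h; apply: limr_le; first exact: H2_cvg.
near=> n; have n0 : (0 < n)%N by near: n; exists 1%N.
by rewrite -(prednK n0) H2_series -wsqnorm0.
Unshelve. all: by end_near. Qed.

Lemma H2_of_coefs b (K : R) : (forall N, wsqnorm 0 b N <= K) ->
  exists2 f : H2 R, (forall n, (0 < n)%N -> f n = b n) & H2_sqnorm f <= K.
Proof.
move=> bK; pose b' n := if (0 < n)%N then b n else 0.
have b'E N : \sum_(0 <= n < N) cnorm (b' n) ^+ 2 <= K.
  case: N => [|N]; first by rewrite big_geq// (le_trans (wsqnorm_ge0 _ _ _) (bK 0%N)).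
  have b'0 : b' 0%N = 0 by [].
  rewrite big_ltn// b'0 Normc.normc0 expr0n add0r big_nat.
  apply: le_trans (bK N); rewrite wsqnorm0 [leRHS]big_nat.
  by apply: ler_sum => n /andP[n0 _]; rewrite /b' n0.
have b'P : b' \in H2_pred.
  apply/H2_predP; split=> //; apply: nondecreasing_is_cvgn.
    by apply: nondecreasing_series => k _ _; exact: sqr_ge0.
  by exists K => _ [N _ <-]; exact: b'E.
exists (MkH2 b'P) => [n n0|]; first by rewrite /= /b' n0.
by apply: H2_sqnorm_le => N; rewrite wsqnorm0 -H2_series; exact: b'E.
Qed.

Lemma H2_tail f (e : R) : 0 < e -> exists N, forall m n, (N <= m)%N ->
  wsqnorm 0 (fun k => if (m < k)%N then f k else 0) n <= e.
Proof.
move=> e0; have /cvgrPdist_le/(_ _ e0)[N _ hN] := H2_cvg (f := f).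
exists N => m n Nm; have [nm|mn] := leqP n m.
  rewrite wsqnorm0 big1_seq ?(ltW e0)// => k /andP[_]; rewrite mem_index_iota ltnS.
  by move=> /andP[_ kn]; rewrite ifN ?Normc.normc0 ?expr0n// -leqNgt (leq_trans kn).
have := hN m.+1 (leqW Nm); rewrite -/(H2_sqnorm f) H2_series.
move=> /(le_trans (ler_norm _)); apply: le_trans.
rewrite lerBrDr; apply: le_trans (H2_wsqnorm_le f n).
rewrite !wsqnorm0 (@big_cat_nat _ _ _ m.+1 1 n.+1)// ?leqW//= big1_seq; last first.
  move=> k /andP[_]; rewrite mem_index_iota ltnS => /andP[_ km].
  by rewrite ifN ?Normc.normc0 ?expr0n// -leqNgt.
rewrite add0r addrC (@big_cat_nat _ _ _ m.+1 1 n.+1)// ?leqW//= lerD2l.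
rewrite big_nat [leRHS]big_nat; apply: ler_sum => k /andP[mk _]; rewrite mk.
by [].
Qed.

Lemma dirichlet_partial_tail a m n s : (m <= n)%N ->
  dirichlet_partial a n s - dirichlet_partial a m s =
  dirichlet_partial (fun k => if (m < k)%N then a k else 0) n s.
Proof.
move=> mn; rewrite /dirichlet_partial (@big_cat_nat _ _ _ m.+1 1 n.+1)//=.
rewrite addrAC subrr add0r [RHS](@big_cat_nat _ _ _ m.+1 1 n.+1)//=.
rewrite [X in _ = X + _]big1_seq ?add0r; last first.
  by move=> k; rewrite mem_index_iota ltnS => /andP[_ /andP[_ km]]; rewrite ltnNge km mul0r.
by rewrite big_nat [RHS]big_nat; apply: eq_bigr => k /andP[-> _].
Qed.

Lemma H2_eval_cvg f s : 2^-1 < Re s ->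
  dirichlet_partial f n s @[n --> \oo] --> H2_eval f s.
Proof.
move=> s2; have [Z Z0 hZ] := dirichlet_partial_le_wsqnorm s2.
suff [l hl] : exists l : R[i], dirichlet_partial f n s @[n --> \oo] --> l.
  by rewrite /H2_eval /dirichlet_sum (cvg_lim _ hl).
apply: ccauchy_cvg => e e0.
have eZ : 0 < (e / Z) ^+ 2 by rewrite exprn_gt0// divr_gt0.
have [N hN] := H2_tail f eZ; exists N => n m Nn Nm.
wlog mn : n m Nn Nm / (m <= n)%N => [H|].
  have [|/ltnW] := leqP m n; first exact: H.
  by rewrite cdistC; exact: H.
rewrite dirichlet_partial_tail//.
rewrite -[leRHS](@divfK _ Z) ?gt_eqF//; apply: (hZ _ _ 0); rewrite ?divr_gt0 ?add0r//.
exact: hN.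
Qed.

End HardySpaceTheory.

(** * Construction of composition operators *)

Section CompositionOperator.
Context {R : realType}.
Implicit Types (a b c : nat -> R[i]) (s w x y z : R[i]) (p q phi : R[i] -> R[i]).
Implicit Types (sg t : R) (f g : H2 R).
Local Notation cnorm := (@Normc.normc R).
Local Notation Re := (@complex.Re R).
Local Notation Im := (@complex.Im R).

Lemma cvg_cnorm (u : nat -> R[i]) l :
  u n @[n --> \oo] --> l -> cnorm (u n) @[n --> \oo] --> cnorm l.
Proof.
move=> /cvg_cnormP ul; apply/cvgrPdist_le => e e0.
apply: filterS (ul e e0) => n; apply: le_trans; rewrite ler_norml.
have := cnorm_ler_dist l (u n); have := cnorm_ler_dist (u n) l.
by rewrite (cdistC l); move=> h1 h2; apply/andP; split; lra.
Qed.

Lemma wsqnorm_cvg (sg_ : nat -> R) sg (a_ : nat -> nat -> R[i]) a N :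
  sg_ i @[i --> \oo] --> sg -> (forall k, a_ i k @[i --> \oo] --> a k) ->
  wsqnorm (sg_ i) (a_ i) N @[i --> \oo] --> wsqnorm sg a N.
Proof.
move=> hsg ha; rewrite /wsqnorm; elim: (index_iota _ _) => [|k r IH].
  rewrite big_nil (_ : (fun=> _) = fun=> 0); first exact: cvg_cst.
  by apply/funext => i; rewrite big_nil.
rewrite big_cons (_ : (fun i => _) = fun i =>
   (cnorm (a_ i k) * expR (- (ln k%:R * sg_ i))) ^+ 2 +
   \sum_(n <- r) (cnorm (a_ i n) * expR (- (ln n%:R * sg_ i))) ^+ 2); last first.
  by apply/funext => i; rewrite big_cons.
apply: cvgD IH; rewrite expr2 (_ : (fun i => _) = fun i =>
   (cnorm (a_ i k) * expR (- (ln k%:R * sg_ i))) *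
   (cnorm (a_ i k) * expR (- (ln k%:R * sg_ i)))); last by [].
suff h : (cnorm (a_ i k) * expR (- (ln k%:R * sg_ i))) @[i --> \oo] -->
  (cnorm (a k) * expR (- (ln k%:R * sg))) by exact: cvgM.
apply: cvgM; first exact: cvg_cnorm.
apply: continuous_cvg; first exact: continuous_expR.
by apply: cvgN; apply: cvgMr.
Qed.

Lemma wsqnorm_leN sg a N M : (N <= M)%N -> wsqnorm sg a N <= wsqnorm sg a M.
Proof.
move=> NM; rewrite /wsqnorm (@big_cat_nat _ _ _ N.+1 1 M.+1)//= lerDl.
by apply: sumr_ge0 => n _; exact: sqr_ge0.
Qed.

(** A completeness statement for H^2 in which the norm of the i-th term is taken on the
line Re s = sg_i, with sg_i tending to 0: approximation of f o phi is only uniform on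
the half-planes C_e with e > 0. *)
Lemma H2_limit (P : nat -> nat -> R[i]) (sg_ : nat -> R) (K B : R) :
  (forall i, P i 0%N = 0) -> sg_ i @[i --> \oo] --> 0 -> (forall i, sg_ i <= B) ->
  (forall e : R, 0 < e -> exists I, forall i j N, (I <= i)%N -> (i <= j)%N ->
     wsqnorm (sg_ i) (fun k => P j k - P i k) N <= e) ->
  (forall e : R, 0 < e -> exists I, forall i N, (I <= i)%N ->
     wsqnorm (sg_ i) (P i) N <= K + e) ->
  exists2 f : H2 R, H2_sqnorm f <= K &
    forall e : R, 0 < e -> exists I, forall i N, (I <= i)%N ->
      wsqnorm (sg_ i) (fun k => f k - P i k) N <= e.
Proof.
move=> P0 sg0 sgB PC PK.
have : forall k, exists l : R[i], P i k @[i --> \oo] --> l.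
  case=> [|k]; first by exists 0; under eq_fun do rewrite P0; exact: cvg_cst.
  apply: ccauchy_cvg => e e0.
  (* As sg_i <= B, the weight of the coefficient of index k+1 is at least v. *)
  pose v := expR (- (ln k.+1%:R * B)) : R; have v0 : 0 < v by exact: expR_gt0.
  have ev : 0 < (e * v) ^+ 2 by rewrite exprn_gt0// mulr_gt0.
  have [I hI] := PC _ ev; exists I => n m In Im.
  wlog nm : n m In Im / (n <= m)%N => [H|].
    have [|/ltnW] := leqP n m; first exact: H.
    by rewrite cdistC; exact: H.
  rewrite cdistC -(ler_pM2r v0).
  rewrite -ler_sqr ?nnegrE ?mulr_ge0 ?normc_ge0 ?(ltW v0) ?(ltW e0)//.
  apply: le_trans (hI n m k.+1 In nm).
  rewrite /wsqnorm big_nat_recr//= -[leLHS]add0r lerD//.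
    by apply: sumr_ge0 => ? _; exact: sqr_ge0.
  rewrite lerXn2r ?nnegrE ?mulr_ge0 ?normc_ge0 ?(ltW v0) ?expR_ge0//.
  by rewrite ler_wpM2l ?normc_ge0// ler_expR lerN2 ler_wpM2l ?ln_nat_ge0.
move=> /choice[b hb].
have bK N : wsqnorm 0 b N <= K.
  apply/ler_addgt0Pr => e e0; have [I hI] := PK e e0.
  have h := @wsqnorm_cvg sg_ 0 P b N sg0 hb.
  by apply: (cvgr_to_le h); exists I => // i /= Ii; exact: hI.
have [f fb fK] := H2_of_coefs bK; exists f => // e e0.
have [I hI] := PC e e0; exists I => i N Ii.
have -> : wsqnorm (sg_ i) (fun k => f k - P i k) N =
          wsqnorm (sg_ i) (fun k => b k - P i k) N.
  by rewrite /wsqnorm big_nat [RHS]big_nat; apply: eq_bigr => k /andP[k0 _]; rewrite fb.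
have h : wsqnorm (sg_ i) (fun k => P j k - P i k) N @[j --> \oo] -->
    wsqnorm (sg_ i) (fun k => b k - P i k) N.
  by apply: wsqnorm_cvg => [|k]; [exact: cvg_cst|apply: cvgB; [exact: hb|exact: cvg_cst]].
by apply: (cvgr_to_le h); exists i => // j /= ij; exact: hI.
Qed.

Lemma dpoly_normal p : dpoly p -> exists a N,
  (forall k, ~~ (0 < k <= N)%N -> a k = 0) /\
  forall M s, (N <= M)%N -> p s = dirichlet_partial a M s.
Proof.
move=> [a [N pE]]; exists (fun k => if (0 < k <= N)%N then a k else 0), N.
split=> [k /negbTE -> //|M s NM]; rewrite pE (dirichlet_partial_widen _ _ NM).
rewrite /dirichlet_partial big_nat [RHS]big_nat; apply: eq_bigr => k.
by move=> /andP[-> _].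
Qed.

Lemma dirichlet_partialB a b N s : dirichlet_partial (fun k => a k - b k) N s =
  dirichlet_partial a N s - dirichlet_partial b N s.
Proof.
rewrite /dirichlet_partial -sumrN -big_split/=; apply: eq_bigr => n _.
by rewrite mulrBl.
Qed.

Lemma harmonic_le (e : R) : 0 < e -> exists I, forall i, (I <= i)%N -> harmonic i <= e.
Proof.
move=> e0; have /cvgrPdist_le/(_ _ e0)[I _ hI] := @cvg_harmonic R.
exists I => i /hI; rewrite sub0r normrN; apply: le_trans; exact: ler_norm.
Qed.

(** The maps of characteristic 1 through which composition is studied.  It contains the
elements of G_{>0} of characteristic 1, and also the maps built from local inverses
of those, which have no convergent expansion at hand. *)
Definition symbol phi := (forall s, 0 < Re s -> Re s <= Re (phi s)) /\
  (forall e : R, 0 < e -> uap e (fun s => phi s - s)).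

(** Approximate f_i o phi within 1/(i+1) on C_{1/(i+1)} by a Dirichlet polynomial P_i, where
f_i is the i-th partial sum of f.  By wsqnorm_comp_le, applied to f_j - f_i and to f_i,
the P_i satisfy the hypotheses of H2_limit on the lines Re s = 2/(i+1).  Their limit g
takes the values of f o phi on C_{1/2} since evaluation there is controlled by
the norm. *)
Lemma comp_exists phi f : symbol phi -> exists2 g : H2 R,
  H2_sqnorm g <= H2_sqnorm f &
  forall s, 2^-1 < Re s -> H2_eval g s = H2_eval f (phi s).
Proof.
move=> [phi0 uphi].
have : forall i, exists aN : (nat -> R[i]) * nat,
  (forall k, ~~ (0 < k <= aN.2)%N -> aN.1 k = 0) /\
  (forall M s, (aN.2 <= M)%N -> harmonic i < Re s ->
    cnorm (dirichlet_partial f i (phi s) - dirichlet_partial aN.1 M s) <= harmonic i).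
  move=> i; have h0 : 0 < harmonic i :> R by exact: harmonic_gt0.
  have u : uap (harmonic i) (fun s => dirichlet_partial f i (phi s)).
    apply: (uap_comp (ltW h0) (uap_dpoly (harmonic i) (dpoly_partial f i))).
      exact: uphi.
    by move=> s hs; apply: lt_le_trans hs (phi0 _ (lt_trans h0 hs)).
  have [p /dpoly_normal[a [N [aN pE]]] hp] := u _ h0.
  by exists (a, N); split=> // M s NM hs; rewrite -pE// hp.
move=> /choice[PM hPM].
pose P i := (PM i).1.
(* The approximation holds on C_{1/(i+1)}; the means are taken on a line inside it. *)
pose sg_ i : R := 2 * harmonic i.
have har1 i : harmonic i <= 1 :> R by rewrite invf_le1 ?ler1n.
have [|||e e0|e e0|g gK hg] := @H2_limit P sg_ (H2_sqnorm f) 2.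
- by move=> i; rewrite /P (hPM i).1.
- by rewrite -(mulr0 2); apply: cvgMr; exact: cvg_harmonic.
- by move=> i; rewrite /sg_ -[leRHS]mulr1 ler_pM2l.
- have e6 : 0 < e / 6 by rewrite divr_gt0.
  have e12 : 0 < e / 12 by rewrite divr_gt0.
  have [I hI] := harmonic_le e12; have [J hJ] := H2_tail f e6.
  exists (maxn I J) => i j N; rewrite geq_max => /andP[Ii Ji] ij.
  have h0 : 0 < harmonic i :> R by exact: harmonic_gt0.
  pose M := maxn N (maxn (PM i).2 (PM j).2).
  apply: le_trans (wsqnorm_leN _ _ (leq_maxl N (maxn (PM i).2 (PM j).2))) _.
  have hd : 0 <= 2 * harmonic i :> R by rewrite mulr_ge0// ltW.
  have hsg : harmonic i < sg_ i by rewrite /sg_ ltr_pMl// ltr1n.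
  have hij : harmonic j <= harmonic i :> R by rewrite lef_pV2 ?posrE// ler_nat ltnS.
  apply: le_trans (@wsqnorm_comp_le _ (fun k => if (i < k)%N then f k else 0) j _ _
     phi (harmonic i) _ (2 * harmonic i) (ltW h0) hsg hd (uphi _ h0) _ _) _.
  + by move=> s hs; apply: le_trans (phi0 _ (lt_trans h0 hs)); rewrite ltW// (lt_trans h0).
  + move=> s hs; rewrite -dirichlet_partial_tail// dirichlet_partialB.
    rewrite [X in cnorm X](_ : _ =
      (dirichlet_partial f j (phi s) - dirichlet_partial (P j) M s) -
      (dirichlet_partial f i (phi s) - dirichlet_partial (P i) M s)); last by ring.
    apply: le_trans (cnormB _ _) _; rewrite mulr_natl mulr2n lerD//.
      apply: le_trans (hij); apply: (hPM j).2; last exact: le_lt_trans hij hs.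
      by rewrite leq_max leq_max leqnn !orbT.
    by apply: (hPM i).2 => //; rewrite leq_max leq_max leqnn !orbT.
  have := hJ i j Ji; have := hI i Ii; have := har1 i; rewrite wsqnorm0.
  have : 0 <= \sum_(1 <= n < j.+1) cnorm (if (i < n)%N then f n else 0) ^+ 2.
    by apply: sumr_ge0 => n _; exact: sqr_ge0.
  move: (\sum_(_ <= _ < _) _) h0; rewrite {hd hsg hij}.
  by move: (harmonic i) => h T h0 T0 h1 h12 T6; nra.
- have F0 := H2_sqnorm_ge0 f; have F2 : 0 < H2_sqnorm f + 2 by rewrite ltr_wpDl.
  have eF : 0 < e / (H2_sqnorm f + 2) by rewrite divr_gt0.
  have [I hI] := harmonic_le eF; exists I => i N Ii.
  have h0 : 0 < harmonic i :> R by exact: harmonic_gt0.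
  pose M := maxn N (PM i).2.
  apply: le_trans (wsqnorm_leN _ _ (leq_maxl N (PM i).2)) _.
  have hsg : harmonic i < sg_ i by rewrite /sg_ ltr_pMl// ltr1n.
  apply: le_trans (@wsqnorm_comp_le _ f i _ _
     phi (harmonic i) _ (harmonic i) (ltW h0) hsg (ltW h0) (uphi _ h0) _ _) _.
  + by move=> s hs; apply: le_trans (phi0 _ (lt_trans h0 hs)); rewrite ltW// (lt_trans h0).
  + by move=> s hs; apply: (hPM i).2 => //; rewrite leq_max leqnn orbT.
  rewrite -wsqnorm0; have := H2_wsqnorm_le f i; have := wsqnorm_ge0 0 f i.
  have := hI i Ii; rewrite ler_pdivlMr//; have := har1 i; move: h0.
  by rewrite {hsg}; move: (harmonic i) (wsqnorm _ _ _) (H2_sqnorm f) F0 F2 => h W F *; nra.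
exists g => // s s2.
pose th := (2^-1 + Re s) / 2.
have th2 : 2^-1 < th by rewrite /th; lra.
have ths : th < Re s by rewrite /th; lra.
have s0 : 0 < Re s by apply: lt_trans s2; rewrite invr_gt0.
have [Z Z0 hZ] := dirichlet_partial_le_wsqnorm th2.
have phis2 : 2^-1 < Re (phi s) by apply: lt_le_trans s2 (phi0 _ s0).
apply: (@norm_cvg_unique _ _ (dirichlet_partial f i (phi s) @[i --> \oo])); last first.
  exact: H2_eval_cvg.
apply/cvg_cnormP => e e0.
have eZ : 0 < e / 2 / Z by rewrite !divr_gt0.
have eZ2 : 0 < (e / 2 / Z) ^+ 2 by rewrite exprn_gt0.
have e2 : 0 < e / 2 by rewrite divr_gt0.
have [I hI] := hg _ eZ2; have [J hJ] := harmonic_le e2.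
have st : 0 < (Re s - th) / 2 by rewrite divr_gt0// subr_gt0.
have [L hL] := harmonic_le st.
exists (maxn I (maxn J L)) => // i /=; rewrite !geq_max => /and3P[Ii Ji Li].
have his : harmonic i < Re s.
  by apply: le_lt_trans (hL i Li) _; have := lt_trans (ltac:(lra) : 0 < 2^-1) th2; lra.
have h1 : cnorm (H2_eval g s - dirichlet_partial (P i) (PM i).2 s) <= e / 2.
  have cv : (dirichlet_partial g N s - dirichlet_partial (P i) (PM i).2 s)
     @[N --> \oo] --> H2_eval g s - dirichlet_partial (P i) (PM i).2 s.
    by apply: cvgB; [exact: H2_eval_cvg|exact: cvg_cst].
  apply: (cvg_cnorm_le cv); exists (PM i).2 => // N /= MN.
  have -> : dirichlet_partial (P i) (PM i).2 s = dirichlet_partial (P i) N s.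
    rewrite (dirichlet_partial_widen _ _ MN) /dirichlet_partial.
    apply: eq_bigr => k _; case: leqP => // Mk; rewrite /P (hPM i).1//.
    by rewrite negb_and -(ltnNge (PM i).2) Mk orbT.
  rewrite -dirichlet_partialB -[leRHS](@divfK _ Z) ?gt_eqF//.
  apply: (hZ _ _ (sg_ i)) => //; first exact: hI.
  by rewrite /sg_; have := hL i Li; lra.
have h2 := (hPM i).2 (PM i).2 s (leqnn _) his.
apply: le_trans (cdistD (dirichlet_partial (P i) (PM i).2 s) _ _) _.
rewrite (splitr e) lerD// ?(le_trans h2 (hJ i Ji))//.
by rewrite cdistC.
Qed.

End CompositionOperator.

(** * Uniqueness, linearity and contractivity *)

Section CompositionOperatorTheory.
Context {R : realType}.
Implicit Types (a b c : nat -> R[i]) (s w x y z : R[i]) (p q phi : R[i] -> R[i]).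
Implicit Types (sg t : R) (f g : H2 R).
Local Notation cnorm := (@Normc.normc R).
Local Notation Re := (@complex.Re R).
Local Notation Im := (@complex.Im R).

Lemma wsqnorm_le_sup sg a N (B : R) :
  (forall t, cnorm (dirichlet_partial a N (sg +i* t)%C) <= B) ->
  wsqnorm sg a N <= B ^+ 2.
Proof.
move=> hB; have [F oF hF] := osc_sqnorm_partial a N sg.
have B0 : 0 <= B by apply: le_trans (hB 0); exact: normc_ge0.
rewrite -subr_ge0; apply: (osc_mean (oscZ (-1) oF)) => t.
rewrite mulN1r cReN -addrA -opprD -hF subr_ge0 lerXn2r// nnegrE//.
exact: normc_ge0.
Qed.

Lemma H2_evalD f g s : 2^-1 < Re s -> H2_eval (f + g) s = H2_eval f s + H2_eval g s.
Proof.
move=> s2; apply: (@norm_cvg_unique _ _ (dirichlet_partial (f + g) n s @[n --> \oo])).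
  exact: H2_eval_cvg.
rewrite (_ : (fun n => _) = fun n => dirichlet_partial f n s + dirichlet_partial g n s).
  by apply: cvgD; exact: H2_eval_cvg.
apply/funext => n; rewrite /dirichlet_partial -big_split/=.
by apply: eq_bigr => k _; rewrite -mulrDl.
Qed.

Lemma H2_evalZ (k : R[i]) f s : 2^-1 < Re s -> H2_eval (k *: f) s = k * H2_eval f s.
Proof.
move=> s2; apply: (@norm_cvg_unique _ _ (dirichlet_partial (k *: f) n s @[n --> \oo])).
  exact: H2_eval_cvg.
rewrite (_ : (fun n => _) = fun n => k * dirichlet_partial f n s).
  by apply: cvgMr; exact: H2_eval_cvg.
apply/funext => n; rewrite /dirichlet_partial mulr_sumr.
by apply: eq_bigr => m _; rewrite mulrA.
Qed.

(** If the series vanishes on C_{1/2}, then its partial sums are uniformly small on the line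
Re s = 1, and so are their mean squares by wsqnorm_le_sup. *)
Lemma H2_eval_eq0 f : (forall s, 2^-1 < Re s -> H2_eval f s = 0) -> f = 0.
Proof.
move=> f0; apply/val_inj/funext => -[|k] /=.
  by have /H2_predP[] := H2_coefP f.
have half1 : 2^-1 < 1 :> R by rewrite invf_lt1// ltr1n.
have [Z Z0 hZ] := dirichlet_partial_le_wsqnorm half1.
pose v := expR (- (ln k.+1%:R * 1)) : R; have v0 : 0 < v by exact: expR_gt0.
(* Here v is the modulus of (k+1)^{-s} on the line Re s = 1. *)
suff H (e : R) : 0 < e -> cnorm (f k.+1) * v <= e * Z.
  apply: Normc.eq0_normc; apply/eqP; rewrite eq_le normc_ge0 andbT.
  rewrite -(pmulr_lle0 _ v0); apply/ler_addgt0Pr => e e0; rewrite add0r.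
  by rewrite -[leRHS](@divfK _ Z) ?gt_eqF// H// divr_gt0.
move=> e0; have e2 : 0 < e ^+ 2 by rewrite exprn_gt0.
have [N hN] := H2_tail f e2; pose M := maxn N k.+1.
have h : wsqnorm 1 f M <= (e * Z) ^+ 2.
  apply: wsqnorm_le_sup => t; set s := (1 +i* t)%C.
  have s2 : 2^-1 < Re s by [].
  have cv : (dirichlet_partial f n s - dirichlet_partial f M s) @[n --> \oo] -->
      H2_eval f s - dirichlet_partial f M s.
    by apply: cvgB; [exact: H2_eval_cvg|exact: cvg_cst].
  rewrite -normcN -[X in cnorm X]add0r -(f0 s s2).
  apply: (cvg_cnorm_le cv); exists M => // n /= Mn; rewrite dirichlet_partial_tail//.
  by apply: (hZ _ _ 0) => //; [exact: hN (leq_maxl _ _)|rewrite add0r].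
rewrite -ler_sqr ?nnegrE ?mulr_ge0 ?normc_ge0 ?(ltW v0) ?(ltW e0) ?(ltW Z0)//.
apply: le_trans h; apply: le_trans (wsqnorm_leN _ _ (leq_maxr N k.+1)).
rewrite /wsqnorm big_nat_recr//= -[leLHS]add0r lerD//.
by apply: sumr_ge0 => ? _; exact: sqr_ge0.
Qed.

Lemma H2_eval_inj f g :
  (forall s, 2^-1 < Re s -> H2_eval f s = H2_eval g s) -> f = g.
Proof.
move=> h; apply/eqP; rewrite -subr_eq0; apply/eqP; apply: H2_eval_eq0 => s s2.
by rewrite -scaleN1r H2_evalD// H2_evalZ// h// mulN1r subrr.
Qed.

Lemma comp_opE phi f s : symbol phi -> 2^-1 < Re s ->
  H2_eval (comp_op phi f) s = H2_eval f (phi s).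
Proof.
move=> uphi s2; rewrite /comp_op; case: xgetP => [g _ h|]; first exact: h.
have [g _ hg] := comp_exists f uphi; by move=> /(_ g); case.
Qed.

Lemma comp_op_uniq phi f g : symbol phi ->
  (forall s, 2^-1 < Re s -> H2_eval g s = H2_eval f (phi s)) -> comp_op phi f = g.
Proof. by move=> uphi hg; apply: H2_eval_inj => s s2; rewrite comp_opE// hg. Qed.

Lemma comp_op_sqnorm phi f : symbol phi -> H2_sqnorm (comp_op phi f) <= H2_sqnorm f.
Proof.
move=> uphi; have [g gf hg] := comp_exists f uphi.
by rewrite (comp_op_uniq uphi hg).
Qed.

Lemma symbol_half phi s : symbol phi -> 2^-1 < Re s -> 2^-1 < Re (phi s).
Proof.
move=> [phi0 _] s2; apply: lt_le_trans (s2) (phi0 _ _).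
by apply: lt_trans s2; rewrite invr_gt0.
Qed.

Lemma comp_opD phi f g : symbol phi ->
  comp_op phi (f + g) = comp_op phi f + comp_op phi g.
Proof.
move=> uphi; apply: comp_op_uniq => // s s2.
by rewrite !H2_evalD ?comp_opE//; exact: symbol_half.
Qed.

Lemma comp_opZ phi (k : R[i]) f : symbol phi ->
  comp_op phi (k *: f) = k *: comp_op phi f.
Proof.
move=> uphi; apply: comp_op_uniq => // s s2.
by rewrite !H2_evalZ ?comp_opE//; exact: symbol_half.
Qed.

Lemma comp_opB phi f g : symbol phi ->
  comp_op phi (f - g) = comp_op phi f - comp_op phi g.
Proof. by move=> u; rewrite -(scaleN1r g) comp_opD// comp_opZ// scaleN1r. Qed.

Definition h2norm f : R := Num.sqrt (H2_sqnorm f).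

Lemma h2norm_ge0 f : 0 <= h2norm f. Proof. exact: sqrtr_ge0. Qed.

Lemma h2normD f g : h2norm (f + g) <= h2norm f + h2norm g.
Proof. by rewrite -lecR rmorphD; exact: H2_normD. Qed.

Lemma h2normZ (k : R[i]) f : h2norm (k *: f) = cnorm k * h2norm f.
Proof. by apply: complexI; rewrite rmorphM; exact: H2_normZ. Qed.

Lemma h2normN f : h2norm (- f) = h2norm f.
Proof. by rewrite -scaleN1r h2normZ normcN Normc.normc1 mul1r. Qed.

Lemma h2distD g f h : h2norm (f - h) <= h2norm (f - g) + h2norm (g - h).
Proof. by have := h2normD (f - g) (g - h); rewrite addrA subrK. Qed.

Lemma h2norm_le f (e : R) : 0 <= e -> H2_sqnorm f <= e ^+ 2 -> h2norm f <= e.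
Proof. by move=> e0 h; rewrite /h2norm -[leRHS](ger0_norm e0) -sqrtr_sqr ler_wsqrtr. Qed.

Lemma h2norm_comp_op phi f : symbol phi -> h2norm (comp_op phi f) <= h2norm f.
Proof. by move=> u; apply: ler_wsqrtr; exact: comp_op_sqnorm. Qed.

Lemma H2_denseP (S : set (H2 R)) :
  dense S <-> forall f (e : R), 0 < e -> exists2 g, S g & h2norm (f - g) <= e.
Proof.
split=> [dS f e e0|dS O [f Of] oO].
  have e0' : 0 < (e%:C)%C by rewrite ltcR.
  have [] := dS (ball f (e%:C)%C).
  - by exists f; exact: ballxx.
  - exact: ball_open.
  move=> g [fg Sg]; exists g => //; move: fg; rewrite -ball_normE => /ltW.
  by rewrite -[X in X <= _]/((h2norm (f - g))%:C)%C lecR.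
have : nbhs f O by exact: open_nbhs_nbhs.
move=> /nbhs_ballP[[e e'] /=]; rewrite ltcE/= => /andP[/eqP -> e0] hO.
have e20 : 0 < e / 2 by rewrite divr_gt0.
have [g Sg gf] := dS f _ e20; exists g; split=> //; apply: hO.
rewrite -ball_normE/=.
rewrite -[X in X < _]/((h2norm (f - g))%:C)%C ltcR; apply: le_lt_trans gf _.
by rewrite ltr_pdivrMr// ltr_pMr// ltr1n.
Qed.

End CompositionOperatorTheory.

(** * The inverse of s + psi(s) near infinity *)

Section InverseNearInfinity.
Context {R : realType}.
Implicit Types (a b c : nat -> R[i]) (s w x y z : R[i]) (p q phi psi : R[i] -> R[i]).
Implicit Types (sg t : R) (f g : H2 R).
Local Notation cnorm := (@Normc.normc R).
Local Notation Re := (@complex.Re R).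
Local Notation Im := (@complex.Im R).

(** Terms of a series that converges at s = 1 are bounded there. *)
Lemma expansion_coef_le c psi : dirichlet_expansion c psi ->
  exists2 C : R, 0 <= C & forall n, (0 < n)%N -> cnorm (c n) <= C * n%:R.
Proof.
move=> h; have half0 : 0 < 2^-1 :> R by rewrite invr_gt0.
have [N hN] := uniform_dirichlet_expansion h half0 ltr01.
pose S := \sum_(0 <= n < N.+1) cnorm (c n).
have S0 : 0 <= S by apply: sumr_ge0 => ? _; exact: normc_ge0.
exists (2 + S) => [|n n0]; first by rewrite addr_ge0.
have n1 : 1 <= n%:R :> R by rewrite ler1n.
have [nN|Nn] := leqP n N.
  have cS : cnorm (c n) <= S.
    rewrite /S (bigD1_seq n) ?mem_index_iota ?iota_uniq//= lerDl.
    by apply: sumr_ge0 => ? _; exact: normc_ge0.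
  apply: le_trans cS _; nra.
have half1 : 2^-1 < Re (1 : R[i]) by rewrite /= invf_lt1// ltr1n.
have := hN n (ltnW Nn) 1 half1.
have Nn' : (N <= n.-1)%N by rewrite -ltnS prednK.
have := hN n.-1 Nn' 1 half1.
rewrite -{3}(prednK n0) /dirichlet_partial [X in _ -> cnorm (_ - X) <= _ -> _]big_nat_recr//=.
rewrite prednK// => h1 h2.
have h3 : cnorm (c n * npow_opp n 1) <= 2.
  set u := psi 1 in h1 h2; set v := \sum_(_ <= _ < _) _ in h1 h2.
  have -> : c n * npow_opp n 1 = (u - v) - (u - (v + c n * npow_opp n 1)) by ring.
  by apply: le_trans (cnormB _ _) _; rewrite -[2]/(1 + 1) lerD.
move: h3; rewrite Normc.normcM cnorm_npow_opp mulr1 expRN lnK ?posrE ?ltr0n//.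
rewrite ler_pdivrMr ?ltr0n// => h3; apply: le_trans h3 _.
by rewrite ler_wpM2r ?ler0n// lerDl.
Qed.

(** By expansion_coef_le the series converges absolutely far to the right, and the
terms of index n >= 2 of its derivative tend uniformly to zero there. *)
Lemma expansion_contraction c psi : dirichlet_expansion c psi ->
  exists2 B : R, 1 <= B & forall s w, B <= Re s -> B <= Re w ->
    cnorm (psi s - psi w) <= 2^-1 * cnorm (s - w).
Proof.
move=> h; have [C C0 hC] := expansion_coef_le h.
have [Z Z0 hZ] := @zeta_partial_le R 2 (ltr1n _ 2).
have l0 : 0 < ln 2%:R :> R by rewrite ln_gt0// ltr1n.
(* With |c_n| <= C n, the Lipschitz constant of the sum on Re s >= B is at most
   2 C Z 2^{-(B-4)}, and 2^{-x} <= 1 / (1 + x ln 2). *)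
pose B := 4 + 4 * (C * Z) / ln 2%:R : R.
have CZ0 : 0 <= C * Z by rewrite mulr_ge0// ltW.
have B4 : 4 <= B by rewrite lerDl divr_ge0 ?mulr_ge0// ltW.
exists B => [|s t Bs Bt]; first by lra.
have s0 : 1 < Re s by lra.
have t0 : 1 < Re t by lra.
have ptw x : 1 < Re x -> dirichlet_partial c N x @[N --> \oo] --> psi x.
  move=> x1; apply/cvg_cnormP => e e0.
  have [N hN] := uniform_dirichlet_expansion h ltr01 e0.
  by exists N => // n /= Nn; rewrite cdistC hN.
have cv : (dirichlet_partial c N s - dirichlet_partial c N t) @[N --> \oo] -->
   psi s - psi t by apply: cvgB; exact: ptw.
apply: (cvg_cnorm_le cv); exists 0%N => // N _ /=.
rewrite /dirichlet_partial -sumrB; apply: le_trans (cnorm_sum _ _ _) _.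
pose K := 2 * C * expR (- (ln 2%:R * (B - 4))) * cnorm (s - t).
have K0 : 0 <= K by rewrite !mulr_ge0 ?expR_ge0 ?normc_ge0.
apply: (@le_trans _ _ (\sum_(1 <= n < N.+1) K * expR (- (ln n%:R * 2)))).
  rewrite big_nat [leRHS]big_nat; apply: ler_sum => -[//|[|n]] /andP[_ _].
    by rewrite !npow_opp1 subrr Normc.normc0 mulr_ge0// expR_ge0.
  set m := n.+2; have m0 : 0 < m%:R :> R by [].
  rewrite -mulrBr Normc.normcM.
  apply: le_trans (ler_pM (normc_ge0 _) (normc_ge0 _) (hC m isT)
    (npow_opp_dist_le m Bs Bt)) _.
  have -> : expR (- (ln m%:R * B)) =
      expR (- (ln m%:R * (B - 4))) * expR (- (ln m%:R * 2)) / m%:R / m%:R.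
    rewrite -[X in _ / X]lnK ?posrE// -[X in _ / X / _]lnK ?posrE// -!expRN -!expRD.
    by congr expR; ring.
  have hB : expR (- (ln m%:R * (B - 4))) <= expR (- (ln 2%:R * (B - 4))).
    by rewrite ler_expR lerN2 ler_wpM2r ?subr_ge0// ler_ln ?posrE// ler_nat.
  have lm : ln m%:R <= m%:R :> R by rewrite ltW// ln_sublinear.
  have lm0 := @ln_nat_ge0 R m.
  rewrite [leLHS](_ : _ = (2 * C) * (expR (- (ln m%:R * (B - 4))) *
     (cnorm (s - t) * expR (- (ln m%:R * 2)) * (ln m%:R / m%:R)))); last first.
    by field; rewrite gt_eqF.
  rewrite [leRHS](_ : _ = (2 * C) * (expR (- (ln 2%:R * (B - 4))) *
     (cnorm (s - t) * expR (- (ln m%:R * 2)) * 1))); last by rewrite /K; ring.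
  apply: ler_wpM2l; first by rewrite mulr_ge0.
  have nt0 : 0 <= cnorm (s - t) * expR (- (ln m%:R * 2)).
    by rewrite mulr_ge0 ?normc_ge0 ?expR_ge0.
  apply: ler_pM => //; rewrite ?expR_ge0//.
    by rewrite mulr_ge0// divr_ge0// ltW.
  by rewrite ler_wpM2l// ler_pdivrMr// mul1r.
rewrite -mulr_sumr; apply: le_trans (ler_wpM2l K0 (hZ N)) _.
rewrite /K mulrAC ler_wpM2r ?normc_ge0//.
have -> : ln 2%:R * (B - 4) = 4 * (C * Z).
  by rewrite /B; field; rewrite gt_eqF.
rewrite expRN.
rewrite [leLHS](_ : _ = 2 * (C * Z) / expR (4 * (C * Z))); last by ring.
rewrite ler_pdivrMr ?expR_gt0//.
have := expR_ge1Dx (4 * (C * Z)); lra.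
Qed.

Lemma half_expn_le j : (2^-1 : R) ^+ j <= harmonic j.
Proof.
rewrite exprVn lef_pV2 ?posrE ?exprn_gt0// -natrX ler_nat.
exact: ltn_expl.
Qed.


(** Solve x + psi(x) = w by the Picard iteration x <- w - psi(x), which is a contraction
where Re x >= B.  As |psi| <= K, the iterates started at w with Re w > B + K satisfy
Re x >= B.  Each iterate, minus the identity, is a uniform limit of Dirichlet
polynomials by uap_comp, and the iterates converge uniformly in w. *)
Lemma inverse_near_infinity c psi : dirichlet_expansion c psi ->
  exists B K h,
  [/\ [/\ 1 <= B, 0 < K & forall s, 2^-1 < Re s -> cnorm (psi s) <= K],
      forall x y, B <= Re x -> B <= Re y -> x + psi x = y + psi y -> x = y,
      forall w, B + K < Re w -> [/\ B <= Re (h w), h w + psi (h w) = w &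
        cnorm (h w - w) <= K] &
      uap (B + K) (fun w => h w - w)].
Proof.
move=> h; have [B B1 hB] := expansion_contraction h.
have half0 : 0 < 2^-1 :> R by rewrite invr_gt0.
have half1 : 2^-1 < 1 :> R by rewrite invf_lt1// ltr1n.
have upsi := uap_expansion h half0.
have [K K0 hK] := uap_bounded (ltW half0) upsi.
have hK' s : B <= Re s -> cnorm (psi s) <= K.
  by move=> Bs; apply: hK; apply: lt_le_trans Bs; exact: lt_le_trans B1.
pose X := fix X j w := if j is j'.+1 then w - psi (X j' w) else w.
have XB j w : B + K < Re w -> B <= Re (X j w).
  move=> Bw; elim: j => [|j IH] /=; first by lra.
  rewrite cReB; have := le_trans (ler_norm _) (le_trans (cRe_le_cnorm _) (hK' _ IH)).
  by lra.
have XS j w : B + K < Re w -> cnorm (X j.+1 w - X j w) <= (2^-1) ^+ j * K.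
  move=> Bw; elim: j => [|j IH].
    by rewrite expr0 mul1r /= addrAC subrr add0r normcN hK'//; exact: (XB 0).
  have -> : X j.+2 w - X j.+1 w = psi (X j w) - psi (X j.+1 w) by rewrite /=; ring.
  apply: le_trans (hB _ _ (XB j _ Bw) (XB j.+1 _ Bw)) _.
  by rewrite cdistC exprS -mulrA ler_pM2l.
have XC j d w : B + K < Re w ->
    cnorm (X (j + d)%N w - X j w) <= 2 * K * ((2^-1) ^+ j - (2^-1) ^+ (j + d)).
  move=> Bw; elim: d => [|d IH]; first by rewrite addn0 !subrr Normc.normc0 mulr0.
  rewrite addnS; apply: le_trans (cdistD (X (j + d)%N w) _ _) _.
  apply: le_trans (lerD (XS _ _ Bw) IH) _.
  by rewrite (exprS _ (j + d)) le_eqVlt; apply/orP; left; apply/eqP; field.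
have XC' j m w : B + K < Re w -> (j <= m)%N ->
    cnorm (X m w - X j w) <= 2 * K * (2^-1) ^+ j.
  move=> Bw jm; rewrite -(subnKC jm); apply: le_trans (XC _ _ _ Bw) _.
  by rewrite ler_pM2l ?mulr_gt0// gerBl exprn_ge0// ltW.
have small (e : R) : 0 < e -> exists N, forall j, (N <= j)%N -> 2 * K * (2^-1) ^+ j <= e.
  move=> e0; have eK : 0 < e / (2 * K) by rewrite divr_gt0// mulr_gt0.
  have [N hN] := harmonic_le eK; exists N => j Nj.
  rewrite mulrC -ler_pdivlMr ?mulr_gt0//.
  exact: le_trans (half_expn_le j) (hN _ Nj).
have : forall w, exists l : R[i], B + K < Re w -> X j w @[j --> \oo] --> l.
  move=> w; have [Bw|Bw] := ltP (B + K) (Re w); last by exists 0.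
  suff [l hl] : exists l : R[i], X j w @[j --> \oo] --> l by exists l.
  apply: ccauchy_cvg => e e0; have [N hN] := small e e0; exists N => n m Nn Nm.
  have [nm|/ltnW mn] := leqP n m.
    by rewrite cdistC; apply: le_trans (XC' _ _ _ Bw nm) (hN _ Nn).
  exact: le_trans (XC' _ _ _ Bw mn) (hN _ Nm).
move=> /choice[L hL].
have LX j w : B + K < Re w -> cnorm (L w - X j w) <= 2 * K * (2^-1) ^+ j.
  move=> Bw; have cv : (X m w - X j w) @[m --> \oo] --> L w - X j w.
    by apply: cvgB; [exact: hL|exact: cvg_cst].
  by apply: (cvg_cnorm_le cv); exists j => // m /= jm; exact: XC'.
have LB w : B + K < Re w -> B <= Re (L w).
  move=> Bw; apply/ler_addgt0Pr => e e0; have [N hN] := small e e0.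
  have := le_trans (cRe_le_cnorm _) (le_trans (LX N w Bw) (hN N (leqnn N))).
  rewrite cReB ler_norml => /andP[+ _]; have := XB N w Bw; lra.
have Linv w : B + K < Re w -> L w + psi (L w) = w.
  move=> Bw; apply/eqP; rewrite -subr_eq0; apply/eqP/Normc.eq0_normc/eqP.
  rewrite eq_le normc_ge0 andbT; apply/ler_addgt0Pr => e e0; rewrite add0r.
  have e20 : 0 < e / 2 by rewrite divr_gt0.
  have [N hN] := small _ e20.
  have -> : L w + psi (L w) - w = (L w - X N.+1 w) + (psi (L w) - psi (X N w)).
    by rewrite /=; ring.
  apply: le_trans (le_normcD _ _) _; rewrite (splitr e); apply: lerD.
    exact: le_trans (LX _ _ Bw) (hN _ (leqnSn _)).
  apply: le_trans (hB _ _ (LB _ Bw) (XB N _ Bw)) _.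
  apply: le_trans (ler_wpM2l (ltW half0) (le_trans (LX N _ Bw) (hN _ (leqnn _)))) _.
  by rewrite ler_piMl// ltW.
exists B, K, L; split; [by split| | |].
- move=> x y Bx By xy; apply/eqP; rewrite -subr_eq0; apply/eqP/Normc.eq0_normc/eqP.
  rewrite eq_le normc_ge0 andbT.
  have := hB _ _ By Bx; have -> : psi y - psi x = x - y.
    have -> : psi x = y + psi y - x by rewrite -xy addrAC subrr add0r.
    by ring.
  rewrite (cdistC y x); have := normc_ge0 (x - y); lra.
- move=> w Bw; split; [exact: LB|exact: Linv|].
  by rewrite -{2}(Linv w Bw) opprD addrA subrr add0r normcN hK'// LB.
- have BK0 : 0 <= B + K by rewrite addr_ge0// ?ltW// (lt_le_trans ltr01).
  have uX j : uap (B + K) (fun w => X j w - w).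
    elim: j => [|j IH].
      by apply: uap_ext (uap_cst _ 0) => w _; rewrite subrr.
    apply: (@uap_ext _ _ (fun w => (-1) * psi (X j w))).
      by move=> w _; rewrite mulN1r /= addrAC subrr add0r.
    apply: uapZ => //; apply: (uap_comp BK0 upsi IH) => w Bw.
    by apply: lt_le_trans (XB j w Bw); exact: lt_le_trans B1.
  apply: uap_closed => d d0; have [N hN] := small d d0.
  exists (fun w => X N w - w) => // w Bw.
  rewrite opprB addrA subrK; exact: le_trans (LX N _ Bw) (hN _ (leqnn _)).
Qed.

End InverseNearInfinity.

(** * Cyclic vectors *)

Section Cyclicity.
Context {R : realType}.
Implicit Types (a b c : nat -> R[i]) (s w x y z : R[i]) (p q phi psi : R[i] -> R[i]).
Implicit Types (sg t : R) (f g : H2 R) (T S : H2 R -> H2 R).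
Local Notation cnorm := (@Normc.normc R).
Local Notation Re := (@complex.Re R).
Local Notation Im := (@complex.Im R).

Lemma poly_op_widen T (P : {poly R[i]}) f n : (size P <= n)%N ->
  poly_op T P f = \sum_(i < n) P`_i *: iter i T f.
Proof.
move=> Pn; rewrite /poly_op (big_ord_widen _ (fun i => P`_i *: iter i T f) Pn).
rewrite big_mkcond; apply: eq_bigr => i _; case: ltnP => // Pi.
by rewrite nth_default// scale0r.
Qed.

Lemma poly_opD T (P Q : {poly R[i]}) f :
  poly_op T (P + Q) f = poly_op T P f + poly_op T Q f.
Proof.
have h := leq_maxl (size P) (size Q); have h' := leq_maxr (size P) (size Q).
rewrite (poly_op_widen _ _ h) (poly_op_widen _ _ h').
rewrite (poly_op_widen _ _ (size_polyD P Q)) -big_split/=.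
by apply: eq_bigr => i _; rewrite coefD scalerDl.
Qed.

Lemma poly_opZ T (k : R[i]) (P : {poly R[i]}) f :
  poly_op T (k *: P) f = k *: poly_op T P f.
Proof.
rewrite (poly_op_widen _ _ (size_scale_leq k P)) scaler_sumr.
by apply: eq_bigr => i _; rewrite coefZ scalerA.
Qed.

Lemma poly_opXn T n f : poly_op T 'X^n f = iter n T f.
Proof.
rewrite (@poly_op_widen _ _ _ n.+1) ?size_polyXn// big_ord_recr/= coefXn eqxx.
rewrite scale1r big1 ?add0r// => i _.
by rewrite coefXn ltn_eqF// scale0r.
Qed.

(** Membership in the closure of the orbit of f under polynomials in T. *)
Definition orbit_span T f g := forall e : R, 0 < e ->
  exists P : {poly R[i]}, h2norm (g - poly_op T P f) <= e.

Lemma orbit_span_poly T f P : orbit_span T f (poly_op T P f).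
Proof.
move=> e e0; exists P; rewrite subrr -(scale0r f) h2normZ Normc.normc0 mul0r.
exact: ltW.
Qed.

Lemma orbit_span_iter T f n : orbit_span T f (iter n T f).
Proof. by rewrite -poly_opXn; exact: orbit_span_poly. Qed.

Lemma orbit_span0 T f : orbit_span T f 0.
Proof. by have := orbit_span_poly T f 0; rewrite /poly_op size_poly0 big_ord0. Qed.

Lemma orbit_spanD T f g h :
  orbit_span T f g -> orbit_span T f h -> orbit_span T f (g + h).
Proof.
move=> hg hh e e0; have e2 : 0 < e / 2 by rewrite divr_gt0.
have [P hP] := hg _ e2; have [Q hQ] := hh _ e2.
exists (P + Q); rewrite poly_opD opprD addrACA.
by apply: le_trans (h2normD _ _) _; rewrite (splitr e) lerD.
Qed.

Lemma orbit_spanZ T f (k : R[i]) g : orbit_span T f g -> orbit_span T f (k *: g).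
Proof.
move=> hg e e0.
have k0 : 0 < cnorm k + 1 by rewrite ltr_wpDl// normc_ge0.
have ek : 0 < e / (cnorm k + 1) by rewrite divr_gt0.
have [P hP] := hg _ ek; exists (k *: P); rewrite poly_opZ -scalerBr h2normZ.
rewrite [leRHS](_ : _ = (cnorm k + 1) * (e / (cnorm k + 1))); last first.
  by rewrite mulrC divfK// gt_eqF.
by apply: ler_pM; rewrite ?normc_ge0 ?h2norm_ge0// lerDl.
Qed.

Lemma orbit_span_closed T f g : (forall e : R, 0 < e ->
    exists2 h, orbit_span T f h & h2norm (g - h) <= e) -> orbit_span T f g.
Proof.
move=> H e e0; have e2 : 0 < e / 2 by rewrite divr_gt0.
have [h hh hgh] := H _ e2; have [P hP] := hh _ e2; exists P.
by apply: le_trans (h2distD h _ _) _; rewrite (splitr e) lerD.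
Qed.

Lemma orbit_span_sum T f (r : seq nat) (F : nat -> H2 R) :
  {in r, forall n, orbit_span T f (F n)} -> orbit_span T f (\sum_(n <- r) F n).
Proof.
elim: r => [|n r IH] h; first by rewrite big_nil; exact: orbit_span0.
rewrite big_cons; apply: orbit_spanD; first by apply: h; rewrite inE eqxx.
by apply: IH => k kr; apply: h; rewrite inE kr orbT.
Qed.

Lemma cyclic_op_of_orbit T f : (forall g, orbit_span T f g) -> cyclic_op T.
Proof.
move=> h; exists f; apply/H2_denseP => g e e0; have [P hP] := h g e e0.
by exists (poly_op T P f) => //; exists P.
Qed.

(** If T S = S D then P(T) S f = S P(D) f, so S maps a dense orbit of D to a dense
subset of its range. *)
Lemma cyclic_op_transfer T (D S : H2 R -> H2 R) f :
  (forall g h, S (g + h) = S g + S h) -> (forall (k : R[i]) g, S (k *: g) = k *: S g) ->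
  (forall g, h2norm (S g) <= h2norm g) -> (forall g, T (S g) = S (D g)) ->
  dense (range S) -> (forall g, orbit_span D f g) -> cyclic_op T.
Proof.
move=> SD SZ Sle TS /H2_denseP dS Dcyc; apply: (@cyclic_op_of_orbit _ (S f)) => g e e0.
have e2 : 0 < e / 2 by rewrite divr_gt0.
have [_ [h _ <-] gh] := dS g _ e2; have [P hP] := Dcyc h _ e2; exists P.
have Titer i : iter i T (S f) = S (iter i D f) by elim: i => //= i ->.
have S0 : S 0 = 0 by rewrite -(scale0r 0) SZ !scale0r.
have -> : poly_op T P (S f) = S (poly_op D P f).
  rewrite /poly_op; elim/big_rec2 : _ => [|i y1 y2 _ ->]; first by rewrite S0.
  by rewrite Titer SD SZ.
apply: le_trans (h2distD (S h) _ _) _; rewrite (splitr e) lerD//.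
rewrite -(scaleN1r (S _)) -SZ -SD scaleN1r; exact: le_trans (Sle _) hP.
Qed.

Lemma H2_basis n : (0 < n)%N -> exists E : H2 R, forall k, E k = (k == n)%:R.
Proof.
move=> n0; have [|E hE _] := @H2_of_coefs R (fun k => (k == n)%:R) 1.
  move=> N; rewrite wsqnorm0; have [nN|Nn] := leqP n N.
    rewrite (bigD1_seq n) ?mem_index_iota ?iota_uniq ?n0//= eqxx Normc.normc1 expr1n.
    by rewrite big1 ?addr0// => i /negbTE ->; rewrite Normc.normc0 expr0n.
  rewrite big1_seq ?ler01// => i /andP[_]; rewrite mem_index_iota ltnS => /andP[_ iN].
  by rewrite ltn_eqF ?(leq_ltn_trans iN)// Normc.normc0 expr0n.
exists E => -[|k]; last by rewrite hE.
by have /H2_predP[-> _] := H2_coefP E; rewrite eq_sym gtn_eqF.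
Qed.

Lemma H2_coefB f g k : (f - g : H2 R) k = f k - g k. Proof. by []. Qed.

Lemma H2_coefZ (l : R[i]) f k : (l *: f : H2 R) k = l * f k. Proof. by []. Qed.

Lemma H2_coef_sum (r : seq nat) (F : nat -> H2 R) k :
  (\sum_(n <- r) F n : H2 R) k = \sum_(n <- r) F n k.
Proof. by elim: r => [|n r IH]; rewrite ?big_nil// !big_cons -IH. Qed.

(** The closed span of the orbit contains the basis vectors E_n, by strong induction on n:
removing from D^j f its components of index below n and dividing by lam_n^j f_n gives
E_n plus components of index k > n, which are at most rho_n^j |f_k / f_n|. *)
Lemma diagonal_cyclic (D : H2 R -> H2 R) (lam : nat -> R[i]) (rho : nat -> R) f :
  (forall g n, D g n = lam n * g n) ->
  (forall n, (0 < n)%N -> lam n != 0 /\ f n != 0) ->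
  (forall n, (0 < n)%N -> 0 <= rho n < 1) ->
  (forall n m, (0 < n)%N -> (n < m)%N -> cnorm (lam m) <= rho n * cnorm (lam n)) ->
  forall g, orbit_span D f g.
Proof.
move=> hD hn hrho hlam.
have /choice[E hE] : forall n, exists e_ : H2 R, (0 < n)%N ->
    forall k, e_ k = (k == n)%:R.
  move=> n; have [->|n0] := posnP n; first by exists 0.
  by have [e_ he] := H2_basis n0; exists e_.
have Diter j g k : iter j D g k = lam k ^+ j * g k.
  by elim: j => [|j IH]; rewrite ?mul1r//= hD IH exprS mulrA.
have spanE n : (0 < n)%N -> orbit_span D f (E n).
  elim/ltn_ind: n => n IH n0; have [ln0 fn0] := hn n n0.
  have /andP[r0 r1] := hrho n n0.
  apply: orbit_span_closed => e e0.
  pose A := h2norm f / cnorm (f n).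
  have fnp : 0 < cnorm (f n).
    rewrite lt_neqAle normc_ge0 andbT eq_sym; apply: contra fn0 => /eqP h.
    by apply/eqP/Normc.eq0_normc.
  have lnp : 0 < cnorm (lam n).
    rewrite lt_neqAle normc_ge0 andbT eq_sym; apply: contra ln0 => /eqP h.
    by apply/eqP/Normc.eq0_normc.
  (* The norm of the remaining components is at most rho_n^j A. *)
  have [j hj] : exists j, rho n ^+ j * A <= e.
    have A0 : 0 <= A by rewrite divr_ge0 ?h2norm_ge0// ltW.
    have : rho n ^+ j * A @[j --> \oo] --> (0 * A : R).
      by apply: cvgMl; apply: cvg_expr; rewrite ger0_norm.
    rewrite mul0r => /cvgrPdist_le/(_ e e0)[N _ hN]; exists N.
    have := hN N (leqnn N); rewrite sub0r normrN; apply: le_trans.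
    exact: ler_norm.
  pose k_ := (lam n ^+ j * f n)^-1.
  pose h : H2 R := k_ *: (iter j D f - \sum_(1 <= i < n) (lam i ^+ j * f i) *: E i).
  exists h.
    apply: orbit_spanZ; apply: orbit_spanD; first exact: orbit_span_iter.
    rewrite -scaleN1r; apply: orbit_spanZ; apply: orbit_span_sum => i.
    rewrite mem_index_iota => /andP[i0 iN]; apply: orbit_spanZ; exact: IH.
  have hk k : (0 < k)%N -> h k = if (k < n)%N then 0 else k_ * (lam k ^+ j * f k).
    move=> k0; rewrite /h H2_coefZ H2_coefB H2_coef_sum Diter; case: ltnP => kn; last first.
      rewrite big1_seq ?subr0// => i /andP[_]; rewrite mem_index_iota => /andP[i0 ilt].
      rewrite H2_coefZ hE// gtn_eqF ?mulr0//.
      exact: leq_trans ilt kn.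
    rewrite (bigD1_seq k) ?mem_index_iota ?iota_uniq ?k0//.
    rewrite H2_coefZ hE// eqxx mulr1.
    rewrite big_nat_cond big1 => [|i /andP[/andP[i0 _] ik]].
      by rewrite /= addr0 subrr mulr0.
    by rewrite H2_coefZ hE// eq_sym (negbTE ik) mulr0.
  apply: h2norm_le; first exact: ltW.
  apply: H2_sqnorm_le => N.
  apply: (@le_trans _ _ ((rho n ^+ j * A) ^+ 2)); last first.
    rewrite lerXn2r// nnegrE; last exact: ltW.
    by rewrite mulr_ge0 ?exprn_ge0// divr_ge0 ?h2norm_ge0// ltW.
  have -> : (rho n ^+ j * A) ^+ 2 = (rho n ^+ j / cnorm (f n)) ^+ 2 * H2_sqnorm f.
    have <- : h2norm f ^+ 2 = H2_sqnorm f by rewrite sqr_sqrtr ?H2_sqnorm_ge0.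
    by rewrite /A; field; rewrite gt_eqF.
  apply: le_trans (ler_wpM2l (sqr_ge0 _) (H2_wsqnorm_le f N)).
  rewrite !wsqnorm0 mulr_sumr big_nat [leRHS]big_nat.
  apply: ler_sum => k /andP[k0 _]; rewrite -exprMn lerXn2r//.
  - by rewrite nnegrE normc_ge0.
  - by rewrite nnegrE mulr_ge0 ?normc_ge0// divr_ge0 ?exprn_ge0 ?normc_ge0.
  rewrite H2_coefB hE// hk//.
  have rhs0 : 0 <= rho n ^+ j / cnorm (f n) * cnorm (f k).
    by rewrite mulr_ge0 ?normc_ge0// divr_ge0 ?exprn_ge0 ?normc_ge0.
  case: ltngtP => kn; first by rewrite subr0 Normc.normc0.
    rewrite sub0r normcN /k_ !Normc.normcM Normc.normcV Normc.normcM !cnormX.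
    rewrite invfM -!mulrA mulrCA mulrA mulrC.
    rewrite [leLHS](_ : _ = (cnorm (lam k) ^+ j / cnorm (lam n) ^+ j) *
       (cnorm (f k) / cnorm (f n))); last by ring.
    rewrite [leRHS](_ : _ = rho n ^+ j * (cnorm (f k) / cnorm (f n))); last by ring.
    rewrite ler_wpM2r ?divr_ge0 ?normc_ge0//.
    rewrite ler_pdivrMr ?exprn_gt0// -exprMn lerXn2r ?nnegrE ?normc_ge0//.
      by rewrite mulr_ge0 ?normc_ge0.
    exact: hlam.
  by move: rhs0; rewrite kn /k_ mulVf ?subrr ?Normc.normc0// mulf_neq0// expf_neq0.
move=> g; apply: orbit_span_closed => e e0.
have e2 : 0 < e ^+ 2 by rewrite exprn_gt0.
have [N hN] := H2_tail g e2.
exists (\sum_(1 <= n < N.+1) g n *: E n).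
  apply: orbit_span_sum => n; rewrite mem_index_iota => /andP[n0 _].
  by apply: orbit_spanZ; exact: spanE.
apply: h2norm_le; first exact: ltW.
apply: H2_sqnorm_le => M; apply: le_trans (hN N M (leqnn N)).
rewrite !wsqnorm0 big_nat [leRHS]big_nat; apply: ler_sum => k /andP[k0 _].
rewrite le_eqVlt; apply/orP; left; apply/eqP; congr (cnorm _ ^+ 2).
rewrite H2_coefB H2_coef_sum.
case: ltnP => kN.
  rewrite big1_seq ?subr0// => i /andP[_]; rewrite mem_index_iota ltnS.
  move=> /andP[i0 iN]; rewrite H2_coefZ hE// gtn_eqF ?mulr0//.
  exact: leq_ltn_trans iN kN.
rewrite (bigD1_seq k) ?mem_index_iota ?iota_uniq ?k0//.
rewrite H2_coefZ hE// eqxx mulr1.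
rewrite big_nat_cond big1 => [|i /andP[/andP[i0 _] ik]].
  by rewrite /= addr0 subrr.
by rewrite H2_coefZ hE// eq_sym (negbTE ik) mulr0.
Qed.

End Cyclicity.

(** * The Koenigs map *)

Section Koenigs.
Context {R : realType}.
Implicit Types (a b c : nat -> R[i]) (s w x y z : R[i]) (p q phi psi v u : R[i] -> R[i]).
Implicit Types (sg t : R) (f g : H2 R).
Local Notation cnorm := (@Normc.normc R).
Local Notation Re := (@complex.Re R).
Local Notation Im := (@complex.Im R).

Lemma symbol_expansion c psi phi : dirichlet_expansion c psi ->
  (forall s, 0 < Re s -> phi s = s + psi s) ->
  (forall s, 0 < Re s -> 0 <= Re (psi s)) -> symbol phi.
Proof.
move=> hc phiE psi0; split=> [s s0|e e0].
  by rewrite phiE// cReD lerDl psi0.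
apply: uap_ext (uap_expansion hc e0) => s es.
by rewrite phiE ?(lt_trans e0)// addrAC subrr add0r.
Qed.

Lemma Gpos_Re_ge0 psi :
  (exists tau : R, forall s, half_plane 0 s -> psi s = (0 +i* tau)%C) \/
  (forall s, half_plane 0 s -> half_plane 0 (psi s)) ->
  forall s, 0 < Re s -> 0 <= Re (psi s).
Proof. by case=> [[tau h]|h] s s0; [rewrite h|rewrite ltW// (h s)]. Qed.

(** The constant that puts the Koenigs map in G_{>0} gives a map of characteristic 1 as
well: with another characteristic d, the function (d - 1) s would be a difference of
two Dirichlet series, which are bounded on C_1. *)
Lemma koenigs_symbol phi (c1 : R[i]) : koenigs_map_in_Gpos phi c1 ->
  exists v c psi, [/\ symbol v, dirichlet_expansion c psi,
    forall s, 0 < Re s -> v s = s + psi s &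
    forall s, 0 < Re s -> v (phi s) = v s + c1].
Proof.
move=> [u [[[_ _ [a [theta [uE ha]]]] ufun] [k [d [c [d0 [psi [vE hc psi0]]]]]]]].
have u1 := uap_expansion ha ltr01.
have p1 := uap_expansion hc ltr01.
have d1 : d = 1%N.
  have [M M0 hM] := uap_bounded ler01 u1; have [K K0 hK] := uap_bounded ler01 p1.
  case: d d0 vE => [//|[//|d]] _ vE; exfalso.
  (* A real point s beyond the bound of the right-hand side of (d - 1) s = theta + k - psi. *)
  pose r := 2 + M + K + cnorm k; pose s : R[i] := (r%:C)%C.
  have k0 := normc_ge0 k.
  have r1 : 1 < r by rewrite /r; lra.
  have s0 : half_plane 0 s by rewrite /half_plane/=; lra.
  have : d.+1%:R * s = theta s + k - psi s.
    have h := vE s s0; rewrite (uE s s0) mul1r in h.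
    have -> : d.+1%:R * s = d.+2%:R * s + psi s - psi s - s.
      by rewrite -(natr1 d.+1); ring.
    by rewrite -h; ring.
  move=> /(congr1 cnorm); rewrite Normc.normcM cnorm_nat cnorm_real.
  rewrite ger0_norm ?(ltW (lt_trans ltr01 r1))// => h.
  have : cnorm (theta s + k - psi s) <= M + cnorm k + K.
    apply: le_trans (cnormB _ _) _; rewrite lerD ?hK//.
    by apply: le_trans (le_normcD _ _) _; rewrite lerD2r hM.
  rewrite -h; have : r <= d.+1%:R * r.
    by rewrite ler_peMl ?ler1n// ltW// (lt_trans ltr01).
  by rewrite /r; lra.
exists (fun s => u s + k), c, psi.
have vE' s : 0 < Re s -> u s + k = s + psi s.
  by move=> s0; rewrite (vE s s0) d1 mul1r.
split=> //.
- by apply: (symbol_expansion hc vE'); exact: Gpos_Re_ge0.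
- by move=> s s0; rewrite ufun// addrAC.
Qed.

Lemma iter_comp_opE phi f n s : symbol phi -> 2^-1 < Re s ->
  H2_eval (iter n (comp_op phi) f) s = H2_eval f (iter n phi s).
Proof.
move=> uphi; elim: n s => [//|n IH] s s2.
by rewrite [in LHS]iterS comp_opE// IH ?iterSr//; exact: symbol_half.
Qed.

Lemma dense_range_iter phi n : symbol phi -> dense (range (comp_op phi)) ->
  dense (range (iter n (comp_op phi))).
Proof.
move=> uphi /H2_denseP dphi; apply/H2_denseP.
elim: n => [|n IH] f e e0.
  exists f; first by exists f.
  by rewrite subrr -(scale0r f) h2normZ Normc.normc0 mul0r ltW.
have e2 : 0 < e / 2 by rewrite divr_gt0.
have [_ [g _ <-] fg] := dphi f _ e2; have [_ [h _ <-] gh] := IH g _ e2.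
exists (iter n.+1 (comp_op phi) h); first by exists h.
apply: le_trans (h2distD (comp_op phi g) _ _) _; rewrite (splitr e) lerD//.
by rewrite iterS -comp_opB//; apply: le_trans (h2norm_comp_op _ uphi) gh.
Qed.

Lemma nat_mul_ge (r M : R) : 0 < r -> exists n : nat, M <= n%:R * r.
Proof.
move=> r0; have M0 : 0 <= `|M| / r by rewrite divr_ge0// ltW.
exists (Num.bound (`|M| / r)); rewrite -ler_pdivrMr//.
apply: le_trans (ltW (archi_boundP M0)).
by rewrite ler_wpM2r ?invr_ge0 ?(ltW r0)// ler_norm.
Qed.

(** For n large and Re s > 1/2, phi^n(s) = h(v(s) + n c_1) with h the inverse of v near
infinity, because v(phi^n(s)) = v(s) + n c_1 and Re phi^n(s) is large; so the range of
C_phi^n is contained in the range of C_v. *)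
Lemma dense_range_koenigs phi v c psi (c1 : R[i]) : 0 < Re c1 ->
  symbol phi -> symbol v -> dirichlet_expansion c psi ->
  (forall s, 0 < Re s -> v s = s + psi s) ->
  (forall s, 0 < Re s -> v (phi s) = v s + c1) ->
  dense (range (comp_op phi)) -> dense (range (comp_op v)).
Proof.
move=> c10 uphi uv hc vE vphi dphi.
have [B [K [h [[B1 K0 hK] inj hinv uh]]]] := inverse_near_infinity hc.
have [n hn] := nat_mul_ge (B + K) c10.
have BK0 : 0 <= B + K by lra.
pose hN w := h (w + n%:R * c1).
have Rn w : 0 < Re w -> B + K < Re (w + n%:R * c1).
  move=> w0; rewrite cReD cReM -(rmorph_nat (real_complex R)) /= mul0r subr0; lra.
have uhn : symbol hN.
  split=> [w w0|e e0].
    have [_ _ hw] := hinv _ (Rn w w0).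
    have := le_trans (cRe_le_cnorm _) hw; rewrite cReB -/(hN w) ler_norml => /andP[+ _].
    by rewrite cReD cReM -(rmorph_nat (real_complex R)) /= mul0r subr0; lra.
  apply: (@uap_ext _ _ (fun w => (h (w + n%:R * c1) - (w + n%:R * c1)) + n%:R * c1)).
    by move=> w _; rewrite /hN; ring.
  apply: uapD (uap_cst _ _).
  apply: (uap_comp (ltW e0) uh).
    apply: uap_ext (uap_cst e (n%:R * c1)) => w _.
    by rewrite addrAC subrr add0r.
  by move=> w ew; apply: Rn; exact: lt_trans ew.
have iterv m s : 0 < Re s -> 0 < Re (iter m phi s) /\ v (iter m phi s) = v s + m%:R * c1.
  move=> s0; elim: m => [|m [IH1 IH2]]; first by rewrite mul0r addr0.
  split; first by rewrite iterS; apply: lt_le_trans (uphi.1 _ IH1).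
  by rewrite iterS vphi// IH2 -natr1 mulrDl mul1r addrA.
suff H f : iter n (comp_op phi) f = comp_op v (comp_op hN f).
  move/H2_denseP: (dense_range_iter n uphi dphi) => d; apply/H2_denseP => f e e0.
  have [_ [g _ <-] fg] := d f e e0.
  by exists (comp_op v (comp_op hN g)); [exists (comp_op hN g)|rewrite -H].
apply: H2_eval_inj => s s2.
have s0 : 0 < Re s by apply: lt_trans s2; rewrite invr_gt0.
rewrite iter_comp_opE// !comp_opE//; last exact: symbol_half.
congr (H2_eval f _).
have v0 : 0 < Re (v s) by apply: lt_le_trans (uv.1 _ s0).
have [Bh hE _] := hinv _ (Rn _ v0).
have [is0 viter] := iterv n s s0.
have is2 : 2^-1 < Re (iter n phi s).
  elim: (n) => [//|m IH]; rewrite iterS; exact: symbol_half.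
apply: inj => //; last by rewrite hE -vE.
have := le_trans (ler_norm _) (le_trans (cRe_le_cnorm _) (hK _ is2)).
have := congr1 Re viter; rewrite (vE _ is0) !cReD cReM.
by rewrite -(rmorph_nat (real_complex R)) /= mul0r subr0; lra.
Qed.

Lemma symbol_shift (c1 : R[i]) : 0 <= Re c1 -> symbol (fun s => s + c1).
Proof.
move=> c10; split=> [s _|e _]; first by rewrite cReD lerDl.
by apply: uap_ext (uap_cst e c1) => s _; rewrite addrAC subrr add0r.
Qed.

(** n^{-(s + c_1)} = n^{-c_1} n^{-s}. *)
Lemma comp_op_shift (c1 : R[i]) f n : 0 <= Re c1 ->
  comp_op (fun s => s + c1) f n = npow_opp n c1 * f n.
Proof.
move=> c10.
have [N|g hg _] := @H2_of_coefs R (fun n => npow_opp n c1 * f n) (H2_sqnorm f).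
  apply: le_trans (H2_wsqnorm_le f N); rewrite !wsqnorm0; apply: ler_sum => k _.
  rewrite lerXn2r ?nnegrE ?normc_ge0// Normc.normcM ler_piMl ?normc_ge0//.
  exact: cnorm_npow_opp_le1.
rewrite (@comp_op_uniq _ _ _ g); first last.
- move=> s s2; congr (limn _); apply/funext => N; rewrite /dirichlet_partial.
  rewrite big_nat [RHS]big_nat; apply: eq_bigr => k /andP[k0 _].
  by rewrite hg// npow_oppD; ring.
- exact: symbol_shift.
case: n => [|n]; last by rewrite hg.
have /H2_predP[-> _] := H2_coefP g; have /H2_predP[-> _] := H2_coefP f.
by rewrite mulr0.
Qed.

Lemma shift_cyclic (c1 : R[i]) : 0 < Re c1 ->
  exists f, forall g, orbit_span (comp_op (fun s => s + c1)) f g.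
Proof.
move=> c10; have [Z _ hZ] := @zeta_partial_le R 2 (ltr1n _ 2).
(* The vector with coefficients 1/n. *)
have [N|f hf _] := @H2_of_coefs R (fun n => (expR (- ln n%:R))%:C%C) Z.
  apply: le_trans (hZ N); rewrite wsqnorm0; apply: ler_sum => n _.
  by rewrite cnorm_real ger0_norm ?expR_ge0// -expRM_natl mulrN mulrC.
exists f; apply: (@diagonal_cyclic _ _ (fun n => npow_opp n c1)
  (fun n => expR (- ((ln n.+1%:R - ln n%:R) * Re c1)))).
- by move=> g n; rewrite comp_op_shift// ltW.
- move=> n n0; rewrite hf//; split.
    apply: contraTneq isT => h; have := cnorm_npow_opp n c1.
    by rewrite h Normc.normc0 => /eqP; rewrite eq_sym expR_eq0.
  apply: contraTneq isT => /(congr1 Re)/= /eqP.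
  by rewrite expR_eq0.
- move=> n n0; rewrite expR_ge0 expR_lt1 oppr_lt0 mulr_gt0// subr_gt0.
  by rewrite ltr_ln ?posrE ?ltr0n// ltr_nat.
- move=> n m n0 nm; rewrite !cnorm_npow_opp -expRD ler_expR.
  rewrite -opprD -mulrDl subrK lerN2 ler_wpM2r ?(ltW c10)//.
  by rewrite ler_ln ?posrE ?ltr0n ?ler_nat// (leq_trans _ nm).
Qed.

End Koenigs.

Theorem theorem4p7 (R : realType) (c : nat -> R[i]) (phi : R[i] -> R[i])
    (phi_Gpos : Gpos_expansion 1 c phi)
    (phi_univalent : univalent phi)
    (Re_c1_gt0 : 0 < complex.Re (c 1%N))
    (koenigs_Gpos : koenigs_map_in_Gpos phi (c 1%N))
    (dense_range : dense (range (comp_op phi))) :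
  cyclic_op (comp_op phi).
Proof.
have uphi : symbol phi.
  have [_ [psi [phiE hc psi0]]] := phi_Gpos.
  apply: (symbol_expansion hc) => [s s0|]; last exact: Gpos_Re_ge0.
  by rewrite phiE// mul1r.
have [v [b [psi [uv hb vE vphi]]]] := koenigs_symbol koenigs_Gpos.
have [f hf] := shift_cyclic Re_c1_gt0.
have ush := symbol_shift (ltW Re_c1_gt0).
apply: (@cyclic_op_transfer _ _ (comp_op (fun s => s + c 1%N)) (comp_op v) f) => //.
- by move=> g h; exact: comp_opD.
- by move=> k g; exact: comp_opZ.
- by move=> g; exact: h2norm_comp_op.
- move=> g; apply: H2_eval_inj => s s2.
  have s0 : 0 < complex.Re s by apply: lt_trans s2; rewrite invr_gt0.
  have ps2 := symbol_half uphi s2; have vs2 := symbol_half uv s2.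
  by rewrite !comp_opE// vphi.
- exact: (dense_range_koenigs Re_c1_gt0 uphi uv hb vE vphi dense_range).
Qed.
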